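(* Let a nonlocal solid occupy $\mathcal{B}_t\subset\mathbb{R}^3$ at time $t$, with mass density $\rho$, displacement $\mathbf{u}$, internal energy per unit mass $e$, body force per unit mass $\mathbf{b}$, internal heat generation rate $r$ (per unit mass), heat flux vector $\bm{q}$, and nonlocal stress tensor $\tilde{\bm{\sigma}}$, all fields being sufficiently regular. Assume conservation of mass, and assume that for every part of the solid, occupying $\mathcal{D}_t\subseteq\mathcal{B}_t$ with outward unit normal $\bm{n}$ on $\partial\mathcal{D}_t$, the energy balance $$\frac{\mathrm{d}}{\mathrm{d}t}\int_{\mathcal{D}_t}\rho\left(\tfrac12\dot{u}_i\dot{u}_i+e\right)\mathrm{d}V=\int_{\mathcal{D}_t}\rho\, b_i\dot{u}_i\,\mathrm{d}V+\int_{\partial\mathcal{D}_t}\tilde t_i(\bm{x},t,\bm{n})\,\dot{u}_i\,\mathrm{d}A+\int_{\mathcal{D}_t}\rho\, r\,\mathrm{d}V-\int_{\partial\mathcal{D}_t}h(\bm{x},t,\bm{n})\,\mathrm{d}A$$ holds, where $h(\bm{x},t,\bm{n})=\bm{q}(\bm{x},t)\cdot\bm{n}$ and the surface traction is the nonlocal traction $\tilde t_j(\bm{x},t,\bm{n})=\sum_{i=1}^3 n_i\,I^{1-\alpha}_{x_i}\tilde{\sigma}_{ij}(\bm{x},t)$. Then the energy balance holds pointwise in the form $$\rho\frac{De}{Dt}+\rho\left(\ddot{u}_i-b_i\right)\dot{u}_i-\left(\left(I^{1-\alpha}_{x_i}\tilde{\sigma}_{ij}\right)\dot{u}_j\right)_{,i}=\rho\,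 r-q_{i,i}\qquad\forall\,\bm{x}\in\mathcal{D}_t .$$
   Context: Here $\alpha\in(0,1)$; repeated indices are summed over $1,2,3$; $(\cdot)_{,i}$ is the ordinary partial derivative with respect to the Cartesian coordinate $x_i$; $D/Dt$ is the material time derivative; $\dot{\mathbf{u}}$ is the velocity of the material particle and $\ddot{\mathbf{u}}$ its acceleration (material time derivative of the velocity). $\mathcal{D}_t$ is a material domain, i.e. the image at time $t$, under the motion, of a fixed part of the solid. Riesz-type fractional integral in direction $x_i$, with length scales $l_{A_i},l_{B_i}>0$ (so that the intervals involved lie in the solid): $$I^{1-\alpha}_{x_i}\chi=\tfrac12\Gamma(2-\alpha)\left[l_{B_i}^{\alpha-1}\left({}_{x_i-l_{B_i}}I^{1-\alpha}_{x_i}\chi\right)+l_{A_i}^{\alpha-1}\left({}_{x_i}I^{1-\alpha}_{x_i+l_{A_i}}\chi\right)\right],$$ where ${}_{a}I^{1-\alpha}_{x}\chi=\frac{1}{\Gamma(1-\alpha)}\int_a^x (x-s)^{-\alpha}\chi(s)\,\mathrm{d}s$ and ${}_{x}I^{1-\alpha}_{b}\chi=\frac{1}{\Gamma(1-\alpha)}\int_x^b (s-x)^{-\alpha}\chi(s)\,\mathrm{d}s$ are the left and right fractional integrals (acting in the $i$-th coordinate). *)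

(* Defs.v *)
From HB Require Import structures.
From mathcomp Require Import all_boot all_order all_algebra.
From mathcomp Require Import all_classical all_reals all_analysis.

Set Implicit Arguments.
Unset Strict Implicit.
Unset Printing Implicit Defensive.

Import Order.TTheory GRing.Theory Num.Theory.
Import numFieldNormedType.Exports.

Local Open Scope classical_set_scope.
Local Open Scope ring_scope.

(* Points and vectors of R^3 are row vectors 'rV[R]_3, with coordinates
   x 0 i for i : 'I_3 and Cartesian basis vectors 'e_i. Time-dependent fields
   take the time first: f t x. *)

Section Regularity.
Context {R : realType}.

Definition C1_on {V W : normedModType R} (U : set V) (f : V -> W) :=
  forall x, U x ->
    differentiable f x /\ forall v : V, {for x, continuous ('D_v f)}.

Definition continuous_on {V W : normedModType R} (U : set V) (f : V -> W) :=
  forall x, U x -> {for x, continuous f}.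

(* F t X, with X a material point, is differentiable in time at fixed X, and F
   and its time derivative are jointly continuous in (t, X). *)
Definition C1_in_time {V W : normedModType R} (T : set R) (Omega : set V)
    (F : R -> V -> W) :=
  (forall t X, T t -> Omega X -> derivable (F ^~ X) t 1) /\
  continuous_on (T `*` Omega) (fun p : R * V => F p.1 p.2) /\
  continuous_on (T `*` Omega) (fun p : R * V => derive1 (F ^~ p.2) p.1).

End Regularity.

Section FractionalIntegral.
Context {R : realType}.

Definition Gamma (z : R) : R :=
  \int[lebesgue_measure]_(s in `]0, +oo[) (s `^ (z - 1) * expR (- s)).

(* Left and right fractional integrals of order 1 - alpha; the value of the
   kernel at the single point s = x is irrelevant. *)
Definition left_fracint (alpha a x : R) (chi : R -> R) : R :=
  (Gamma (1 - alpha))^-1 *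
  \int[lebesgue_measure]_(s in `[a, x]) ((x - s) `^ (- alpha) * chi s).

Definition right_fracint (alpha x b : R) (chi : R -> R) : R :=
  (Gamma (1 - alpha))^-1 *
  \int[lebesgue_measure]_(s in `[x, b]) ((s - x) `^ (- alpha) * chi s).

Definition set_coord (x : 'rV[R]_3) (i : 'I_3) (s : R) : 'rV[R]_3 :=
  \row_j (if j == i then s else x 0 j).

Definition riesz_fracint (alpha lA lB : R) (i : 'I_3) (chi : 'rV[R]_3 -> R)
    (x : 'rV[R]_3) : R :=
  let chi_i s := chi (set_coord x i s) in
  2^-1 * Gamma (2 - alpha) *
  (lB `^ (alpha - 1) * left_fracint alpha (x 0 i - lB) (x 0 i) chi_i +
   lA `^ (alpha - 1) * right_fracint alpha (x 0 i) (x 0 i + lA) chi_i).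

(* The matrix with (i, j) entry I^{1-alpha}_{x_i} sigma_ij (no sum over i).
   The length scales may depend on the direction, on time and on position. *)
Definition fracint_stress (alpha : R) (lA lB : 'I_3 -> R -> 'rV[R]_3 -> R)
    (sigma : R -> 'rV[R]_3 -> 'M[R]_3) (t : R) (x : 'rV[R]_3) : 'M[R]_3 :=
  \matrix_(i, j)
    riesz_fracint alpha (lA i t x) (lB i t x) i (fun y => sigma t y i j) x.

Definition nonlocal_traction (alpha : R) (lA lB : 'I_3 -> R -> 'rV[R]_3 -> R)
    (sigma : R -> 'rV[R]_3 -> 'M[R]_3) (t : R) (x n : 'rV[R]_3) : 'rV[R]_3 :=
  \row_j \sum_i n 0 i * fracint_stress alpha lA lB sigma t x i j.

Definition heat_outflow (q : R -> 'rV[R]_3 -> 'rV[R]_3) (t : R)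
    (x n : 'rV[R]_3) : R := \sum_i q t x 0 i * n 0 i.

End FractionalIntegral.

Section Kinematics.
Context {R : realType}.
Variables (Omega : set 'rV[R]_3) (u : R -> 'rV[R]_3 -> 'rV[R]_3).

(* u t X is the displacement at time t of the particle with reference position
   X in Omega. *)
Definition motion (t : R) (X : 'rV[R]_3) : 'rV[R]_3 := X + u t X.

Definition body (t : R) : set 'rV[R]_3 := motion t @` Omega.

(* Inverse motion: the particle located at x at time t. *)
Definition particle (t : R) (x : 'rV[R]_3) : 'rV[R]_3 :=
  xget 0 [set X | Omega X /\ motion t X = x].

Definition material_derive {V : normedModType R} (f : R -> 'rV[R]_3 -> V)
    (t : R) (x : 'rV[R]_3) : V :=
  derive1 (fun s => f s (motion s (particle t x))) t.

(* Spatial velocity and acceleration fields. *)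
Definition velocity (t : R) (x : 'rV[R]_3) : 'rV[R]_3 :=
  derive1 (u ^~ (particle t x)) t.

Definition acceleration : R -> 'rV[R]_3 -> 'rV[R]_3 := material_derive velocity.

(* Regularity of the motion over the time interval T; in particular every
   motion t is a homeomorphism of Omega onto the open set body t. *)
Definition regular_motion (T : set R) :=
  C1_in_time T Omega u /\
  C1_in_time T Omega (fun t X => derive1 (u ^~ X) t) /\
  forall t, T t ->
    [/\ set_inj Omega (motion t),
        open (body t),
        continuous_on (body t) (particle t)
      & C1_on (body t) (velocity t)].

End Kinematics.

Section Integrals.
Context {R : realType}.

Definition vec3 (p : R * R * R) : 'rV[R]_3 :=
  \row_(i < 3) [:: p.1.1; p.1.2; p.2]`_i.

Definition volume_integral (D : set 'rV[R]_3) (f : 'rV[R]_3 -> R) : R :=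
  \int[((lebesgue_measure \x lebesgue_measure) \x lebesgue_measure)%E]_(p in
    vec3 @^-1` D) f (vec3 p).

(* The library norm `|_| on 'rV[R]_3 is the sup norm. *)
Definition euclid_norm (a : 'rV[R]_3) : R := Num.sqrt (\sum_i a 0 i ^+ 2).

(* Indices are taken modulo 3. *)
Definition cross (a b : 'rV[R]_3) : 'rV[R]_3 :=
  \row_k (a 0 (k + 1) * b 0 (k + 2) - a 0 (k + 2) * b 0 (k + 1)).

Definition square : set (R * R) := `[0, 1] `*` `[0, 1].
Definition open_square : set (R * R) := `]0, 1[ `*` `]0, 1[.

Definition patch_normal (psi : R * R -> 'rV[R]_3) (p : R * R) : 'rV[R]_3 :=
  cross ('D_(1, 0) psi p) ('D_(0, 1) psi p).

Definition unit_normal (psi : R * R -> 'rV[R]_3) (p : R * R) : 'rV[R]_3 :=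
  (euclid_norm (patch_normal psi p))^-1 *: patch_normal psi p.

(* psi_0, ..., psi_(m-1) parametrize the boundary of D as a piecewise smooth
   surface oriented by the outward unit normal. Patches may overlap only along
   the images of the edges of the square, where they may also degenerate. *)
Definition boundary_patches (D : set 'rV[R]_3) (m : nat)
    (psi : 'I_m -> R * R -> 'rV[R]_3) :=
  [/\ closure D `\` D° = \bigcup_k (psi k @` square),
      forall k, exists U, [/\ open U, square `<=` U & C1_on U (psi k)],
      forall k l p p', open_square p -> square p' -> psi k p = psi l p' ->
        k = l /\ p = p',
      forall k p, open_square p -> patch_normal (psi k) p != 0
    & forall k p, open_square p -> \forall eps \near 0^'+,
        ~ D (psi k p + eps *: unit_normal (psi k) p) /\
        D (psi k p - eps *: unit_normal (psi k) p)].

(* Integral of f(x, n) dA over the surface parametrized by psi. *)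
Definition surface_integral (m : nat) (psi : 'I_m -> R * R -> 'rV[R]_3)
    (f : 'rV[R]_3 -> 'rV[R]_3 -> R) : R :=
  \sum_k \int[(lebesgue_measure \x lebesgue_measure)%E]_(p in square)
    (f (psi k p) (unit_normal (psi k) p) *
     euclid_norm (patch_normal (psi k) p)).

End Integrals.

Section BalanceLaws.
Context {R : realType}.

(* A part of the solid is a compact set P of particles contained in Omega; it
   occupies motion u t @` P at time t. *)
Definition mass_conservation (T : set R) (Omega : set 'rV[R]_3)
    (u : R -> 'rV[R]_3 -> 'rV[R]_3) (rho : R -> 'rV[R]_3 -> R) :=
  forall P, compact P -> P `<=` Omega -> forall t, T t ->
    is_derive t (1 : R)
      (fun s => volume_integral (motion u s @` P) (rho s)) 0.

(* Energy balance for every part and every time at which the boundary of the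
   region occupied by the part is piecewise smooth. *)
Definition energy_balance (T : set R) (Omega : set 'rV[R]_3)
    (u : R -> 'rV[R]_3 -> 'rV[R]_3) (rho e : R -> 'rV[R]_3 -> R)
    (b : R -> 'rV[R]_3 -> 'rV[R]_3) (r : R -> 'rV[R]_3 -> R)
    (traction : R -> 'rV[R]_3 -> 'rV[R]_3 -> 'rV[R]_3)
    (h : R -> 'rV[R]_3 -> 'rV[R]_3 -> R) :=
  let v := velocity Omega u in
  forall P, compact P -> P `<=` Omega -> forall t, T t ->
  forall m (psi : 'I_m -> R * R -> 'rV[R]_3),
    boundary_patches (motion u t @` P) psi ->
    is_derive t (1 : R)
      (fun s => volume_integral (motion u s @` P)
         (fun x => rho s x * (2^-1 * (\sum_i v s x 0 i * v s x 0 i) + e s x)))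
      (volume_integral (motion u t @` P)
         (fun x => rho t x * \sum_i b t x 0 i * v t x 0 i)
       + surface_integral psi
         (fun x n => \sum_i traction t x n 0 i * v t x 0 i)
       + volume_integral (motion u t @` P) (fun x => rho t x * r t x)
       - surface_integral psi (fun x n => h t x n)).

End BalanceLaws.

(* Main.v *)
Require Import Defs.
From HB Require Import structures.
From mathcomp Require Import all_boot all_order all_algebra.
From mathcomp Require Import all_classical all_reals all_analysis.
From mathcomp Require Import measurable_realfun ring lra.

Set Implicit Arguments.
Unset Strict Implicit.
Unset Printing Implicit Defensive.

Import Order.TTheory GRing.Theory Num.Theory.
Import numFieldNormedType.Exports.

Local Open Scope classical_set_scope.
Local Open Scope ring_scope.

(** The energy balance of a part involves the time derivative of an integral
    over a moving region, body terms and boundary terms. It is localized at a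
    point x, at time t, by taking the parts that occupy at time t a small cube
    of half-side d centred at x, of volume 8 d^3, and by dividing by that
    volume.

    Left-hand side. For a compact part P, the measure rho(s, .) dx restricted
    to the region occupied at time s is pulled back to the particles by the
    inverse motion. Conservation of mass says that this measure gives every
    compact set of particles a mass that does not depend on s; as closed sets
    form a pi-system that generates the Borel sets, the measure itself does
    not depend on s ([eq_weighted_image], [volume_integral_transport]). The
    integral of rho (|v|^2 / 2 + e) is thus an integral of the specific energy
    F(s, X) of the particles against a fixed measure, and the mean value
    theorem in time bounds its derivative by the values of dF/ds times the
    mass of the part ([material_rate_bound]). Since dF/ds = v . a + De/Dt is
    jointly continuous, the derivative is rho (v . a + De/Dt) times the
    volume, up to an arbitrarily small fraction of the volume.

    Right-hand side. The boundary terms are fluxes of the vector fields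
    w_i = sum_j (I sigma_ij) v_j and q_i through the faces of the cube. The
    flux of a field that is differentiable at x is its divergence at x times
    the volume, up to o(d^3), because opposite faces have opposite normals and
    the first order expansions of the field on them differ by 2 d times the
    partial derivative in the mean ([face_pair_flux], [cube_flux]). The body
    terms are means of continuous functions ([cube_mean]).

    Dividing by 8 d^3 bounds the defect of the pointwise equation by any small
    number, so that it vanishes. *)

(** * Limits, derivatives and continuity *)

Lemma cvg_norm_le (R : realType) (U : Type) (F : set_system U) (FF : ProperFilter F)
    (f : U -> R) (l a b : R) :
  f @ F --> l -> (\forall x \near F, `|f x - a| <= b) -> `|l - a| <= b.
Proof.
move=> fl fb; apply/ler_addgt0Pr => e e0.
have : \forall x \near F, `|l - f x| < e by move/cvgrPdist_lt : fl; apply.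
move=> /(filterI fb)/filter_ex[x [xb xe]].
rewrite (_ : l - a = (f x - a) + (l - f x)); last by ring.
by apply: le_trans (ler_normD _ _) (lerD xb (ltW xe)).
Qed.

Lemma eq0_of_small (R : realType) (z K : R) : 0 < K ->
  (forall eps, 0 < eps <= 1 -> `|z| <= eps * K) -> z = 0.
Proof.
move=> K0 zK; apply: contrapT => /eqP; rewrite -normr_gt0 => z0.
have e0 : 0 < Num.min 1 (`|z| / (2 * K)).
  by rewrite lt_min ltr01 divr_gt0// mulr_gt0.
have := zK (Num.min 1 (`|z| / (2 * K))).
rewrite e0 ge_min lexx => /(_ isT) h.
have : Num.min 1 (`|z| / (2 * K)) * K <= `|z| / 2.
  apply: le_trans (_ : `|z| / (2 * K) * K <= _).
    by rewrite ler_wpM2r ?(ltW K0)// ge_min lexx orbT.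
  by rewrite invfM mulrA mulfVK ?gt_eqF.
by move=> /(le_trans h); rewrite leNgt ltr_pdivrMr// ltr_pMr// ltr1n.
Qed.

(** The two ends may come in any order: times before and after the reference
    time are treated together. *)
Lemma MVT_between (R : realType) (f df : R -> R) (s t : R) :
  (forall x, Num.min s t <= x <= Num.max s t -> is_derive x 1 f (df x)) ->
  exists2 c, Num.min s t <= c <= Num.max s t & f s - f t = df c * (s - t).
Proof.
wlog ts : s t / t <= s => [hw|].
  have /orP[ts|st] := le_total t s; first exact: hw.
  rewrite minC maxC => /(hw _ _ st)[c cst fE]; exists c => //.
  by rewrite -opprB fE -mulrN opprB.
rewrite min_r// max_l// => fd.
have [||c] := @MVT_segment _ f df t s ts.
- by move=> x; rewrite in_itv/= => /andP[/ltW tx /ltW xs]; apply: fd; rewrite tx.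
- apply: continuous_in_subspaceT => x; rewrite inE/= in_itv/= => xts.
  by apply/differentiable_continuous/derivable1_diffP; case: (fd x xts).
- by rewrite in_itv/=; exists c.
Qed.

Lemma continuous_on_slice (R : realType) (V W : normedModType R) (T : set R) (A : set V)
    (F : R -> V -> W) (t : R) :
  continuous_on (T `*` A) (fun p : R * V => F p.1 p.2) -> T t ->
  continuous_on A (F t).
Proof.
move=> cF Tt X AX.
apply: (@continuous2_cvg _ _ _ _ (nbhs X) _ (fun=> t) id F t X).
- exact: (cF (t, X)).
- exact: cvg_cst.
- exact: cvg_id.
Qed.

Lemma cvg_sumr (R : realType) (U : Type) (F : set_system U) {FF : Filter F} n
    (f : 'I_n -> U -> R) (l : 'I_n -> R) :
  (forall i, f i @ F --> l i) ->
  (fun x => \sum_i f i x) @ F --> \sum_i l i.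
Proof.
elim: n f l => [|n IH] f l fl.
  by rewrite big_ord0; under eq_fun do rewrite big_ord0; exact: cvg_cst.
rewrite big_ord_recl; under eq_fun do rewrite big_ord_recl.
by apply: cvgD; [exact: fl|apply: IH => i; exact: fl].
Qed.

Lemma continuous_entry (R : realType) (T : topologicalType) m n
    (M : T -> 'M[R]_(m, n)) (x : T) i j :
  {for x, continuous M} -> {for x, continuous (fun y => M y i j)}.
Proof.
move=> cM; exact: (@continuous_comp _ _ _ M (fun A : 'M[R]_(m, n) => A i j) x cM
  (@coord_continuous _ m n i j (M x))).
Qed.

Lemma differentiable_entry (R : realType) (V : normedModType R) m n
    (M : V -> 'M[R]_(m, n)) (x : V) i j :
  differentiable M x -> differentiable (fun y => M y i j) x.
Proof.
move=> dM; exact: (@differentiable_comp _ _ _ _ M (fun A : 'M[R]_(m, n) => A i j)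
  x dM (differentiable_coord (M x) i j)).
Qed.

Lemma differentiable_sumr (R : realType) (V : normedModType R) n
    (f : 'I_n -> V -> R) (x : V) :
  (forall i, differentiable (f i) x) -> differentiable (fun y => \sum_i f i y) x.
Proof.
move=> df; have -> : (fun y => \sum_i f i y) = \sum_i f i.
  by apply/funext => y; rewrite fct_sumE.
exact: differentiable_sum.
Qed.

(** The o(|z - x|) of the definition of differentiability, made uniform over
    the ball of radius d: this is what a flux through a cube of half-side d
    needs. *)
Lemma differentiable_remainder (R : realType) (V W : normedModType R) (f : V -> W)
    (x : V) (eps : R) :
  differentiable f x -> 0 < eps ->
  \forall d \near 0^'+, forall z : V, `|z - x| <= d ->
    `|f z - f x - 'd f x (z - x)| <= eps * d.
Proof.
move=> /diff_locally/eqaddoP h e0.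
have /nbhs_ballP[r /= r0 rP] := h _ e0.
near=> d.
have dr : d < r by near: d; exact: nbhs_right_lt.
move=> y yd; have : ball 0 r (y - x).
  by rewrite -ball_normE /ball_/= sub0r normrN; exact: le_lt_trans dr.
move=> /rP; rewrite /= -[X in `|X| <= _]/(f (y - x + x) - (f x + 'd f x (y - x))).
rewrite subrK opprD addrA => /le_trans; apply.
by rewrite ler_pM2l.
Unshelve. all: by end_near. Qed.

Lemma closed_ball_near (R : realType) (V : normedModType R) (x : V) (A : set V) :
  nbhs x A -> \forall d \near 0^'+, closed_ball x d `<=` A.
Proof.
move=> /nbhs_ballP[r /= r0 rA]; near=> d => y.
have d0 : 0 < d by near: d; exact: nbhs_right_gt.
have dr : d < r by near: d; exact: nbhs_right_lt.
rewrite closed_ballE// /closed_ball_/= => xy; apply: rA.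
by rewrite -ball_normE /ball_/=; exact: le_lt_trans dr.
Unshelve. all: by end_near. Qed.

Lemma continuous_on_compact_bounded (R : realType) (V : normedModType R) (U K : set V)
    (f : V -> R) :
  compact K -> K `<=` U -> continuous_on U f ->
  exists2 M, 0 <= M & forall x, K x -> `|f x| <= M.
Proof.
move=> cK KU cf.
have : compact (f @` K).
  apply: continuous_compact => //.
  apply: continuous_in_subspaceT => x; rewrite inE => Kx; apply: cf; exact: KU.
move=> /compact_bounded[M [_ Mf]]; exists (Num.max M 0 + 1).
  by rewrite addr_ge0// le_max lexx orbT.
move=> x Kx; apply: Mf; last by exists x.
by rewrite ltr_pwDr// le_max lexx.
Qed.

(** * Measurability and integrability on three-dimensional space *)

Lemma bounded_integrable (R : realType) d (T : measurableType d)
    (mu : {measure set T -> \bar R}) (A : set T) (f : T -> R) (M : R) :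
  measurable A -> (mu A < +oo)%E -> measurable_fun A f ->
  (forall x, A x -> `|f x| <= M) -> mu.-integrable A (EFin \o f).
Proof.
move=> mA Afin mf fM; apply: measurable_bounded_integrable => //.
exists M; split; first exact: num_real.
by move=> y My x Ax; exact: le_trans (fM x Ax) (ltW My).
Qed.

Section CountableBase.

(** The members of a family G contain a countable base of neighbourhoods; the
    base need not consist of open sets. With G the measurable sets, this makes
    open sets measurable, and it goes through products. *)
Definition countable_base (T : topologicalType) (G : set_system T) :=
  exists B : nat -> set T, (forall n, G (B n)) /\
    forall x U, nbhs x U -> exists n, B n x /\ B n `<=` U.

Lemma countable_base_prod (T1 T2 : topologicalType) (G1 : set_system T1)
    (G2 : set_system T2) (G : set_system (T1 * T2)%type) :
  (forall A B, G1 A -> G2 B -> G (A `*` B)) ->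
  countable_base G1 -> countable_base G2 -> countable_base G.
Proof.
move=> G12 [B1 [GB1 b1]] [B2 [GB2 b2]].
pose p n : nat * nat := odflt (0, 0)%N (unpickle n).
exists (fun n => B1 (p n).1 `*` B2 (p n).2); split=> [n|]; first exact: G12.
move=> [x y] U [[V1 V2] /= [xV1 yV2] VU].
have [n1 [Bx Bn1]] := b1 _ _ xV1; have [n2 [By Bn2]] := b2 _ _ yV2.
exists (pickle (n1, n2)); rewrite /p pickleK /=; split=> // -[a b] /= [Ba Bb].
by apply: VU; split; [exact: Bn1|exact: Bn2].
Qed.

Lemma countable_base_R (R : realType) :
  countable_base (@measurable _ (measurableTypeR R)).
Proof.
pose p n : rat * rat := odflt (0, 0) (unpickle n).
exists (fun n => `]ratr (p n).1, ratr (p n).2[%classic); split=> [n|x U].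
  exact: measurable_itv.
move=> /nbhs_ballP[e /= e0 eU].
have /rat_in_itvoo[q1] : x - e < x by rewrite gtrBl.
rewrite in_itv/= => /andP[q1l q1x].
have /rat_in_itvoo[q2] : x < x + e by rewrite ltrDl.
rewrite in_itv/= => /andP[xq2 q2r].
exists (pickle (q1, q2)); rewrite /p pickleK /= in_itv/= q1x xq2; split=> // y.
rewrite /= in_itv/= => /andP[yq1 yq2]; apply: eU; rewrite /ball/=.
by rewrite ltr_distlC; apply/andP; split;
  [exact: lt_trans yq1|exact: lt_trans q2r].
Qed.

(** An open set is the union of the countably many members of the base that it
    contains. The map i relates a measurable space to a topological space that
    may be a different type, as triples of reals and row vectors are. *)
Lemma open_measurable_base (T : topologicalType) d (S : measurableType d)
    (i : S -> T) (U : set T) :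
  countable_base (fun A : set T => measurable (i @^-1` A)) ->
  open U -> measurable (i @^-1` U).
Proof.
move=> [B [mB bB]] oU.
rewrite [X in measurable X](_ : _ =
  \bigcup_(n in [set n | B n `<=` U]) (i @^-1` B n)).
  by apply: bigcup_measurable => n _; exact: mB.
apply/seteqP; split=> [x /= Ux|x [n BU Bx]]; last exact: BU.
have [n [Bx BU]] := bB (i x) U (open_nbhs_nbhs (conj oU Ux)).
by exists n.
Qed.

(** The open set U will be the region that the body occupies, outside which the
    spatial fields have no regularity. *)
Lemma open_continuous_measurable (R : realType) (T : topologicalType) d
    (S : measurableType d) (i : S -> T) (f : T -> R) (U : set T) (A : set S) :
  (forall V, open V -> measurable (i @^-1` V)) ->
  open U -> (forall x, U x -> {for x, continuous f}) ->
  measurable A -> A `<=` i @^-1` U -> measurable_fun A (f \o i).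
Proof.
move=> mi oU cf mA AU; apply: (measurability _ (RGenOpens.measurableE R)).
move=> _ [_ [a [b ->] <-]].
have oV : open (U `&` f @^-1` `]a, b[%classic).
  rewrite openE => x [Ux fx]; apply: filterI; first exact: open_nbhs_nbhs.
  by apply: (cf x Ux); apply: open_nbhs_nbhs; split => //; exact: interval_open.
rewrite [X in measurable X](_ : _ = A `&`
  (i @^-1` (U `&` f @^-1` `]a, b[%classic))).
  by apply: measurableI => //; exact: mi.
apply/seteqP; split=> x /=; [case=> Ax fx; do 2?split => //; exact: AU|].
by case=> Ax [_ fx].
Qed.

End CountableBase.

Section Space.
Context {R : realType}.
Local Notation E := (measurableTypeR R * measurableTypeR R * measurableTypeR R)%type.
Local Notation leb := (@lebesgue_measure R).
Local Notation vol := ((leb \x leb) \x leb)%E.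

Lemma open_measurable_R2 (A : set (R * R)) : open A ->
  measurable (A : set (measurableTypeR R * measurableTypeR R)).
Proof.
apply: (@open_measurable_base _ _
  (measurableTypeR R * measurableTypeR R)%type id).
apply: countable_base_prod (countable_base_R R) (countable_base_R R) => X Y.
exact: measurableX.
Qed.

Lemma open_measurable_R3 (A : set (R * R * R)) : open A ->
  measurable (A : set E).
Proof.
apply: (@open_measurable_base _ _ E id).
have b2 : countable_base
    (@measurable _ (measurableTypeR R * measurableTypeR R)%type).
  apply: countable_base_prod (countable_base_R R) (countable_base_R R) => X Y.
  exact: measurableX.
apply: countable_base_prod b2 (countable_base_R R) => X Y.
exact: measurableX.
Qed.

Lemma vec3E (p : R * R * R) : [/\ vec3 p 0 0 = p.1.1, vec3 p 0 1 = p.1.2 &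
  vec3 p 0 (1 + 1) = p.2].
Proof. by rewrite /vec3 !mxE. Qed.

(** Case analysis on the three coordinates, the last one being written in the
    form in which index arithmetic modulo 3 produces it. *)
Lemma ord3P (P : 'I_3 -> Prop) : P 0 -> P 1 -> P (1 + 1) -> forall i, P i.
Proof.
move=> P0 P1 P2 [[|[|[|]]] // j].
- by rewrite (_ : Ordinal j = 0)//; exact: val_inj.
- by rewrite (_ : Ordinal j = 1)//; exact: val_inj.
- by rewrite (_ : Ordinal j = 1 + 1)//; exact: val_inj.
Qed.

Lemma vec3_continuous : continuous (@vec3 R).
Proof.
move=> p; apply/cvgrPdist_lt => e e0.
have: nbhs p (ball p e) by exact: nbhsx_ballx.
apply: filterS => p' [[/= b1 b2] b3].
have -> : (`|vec3 p - vec3 p'| < e) = ball (vec3 p) e (vec3 p') :> Prop.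
  by rewrite -ball_normE.
split=> // i j; rewrite ord1; move: {i} j; have [v0 v1 v2] := vec3E p.
have [w0 w1 w2] := vec3E p'.
by apply: ord3P; rewrite ?v0 ?v1 ?v2 ?w0 ?w1 ?w2.
Qed.

Lemma measurable_vec3 (U : set 'rV[R]_3) : open U ->
  measurable (vec3 @^-1` U : set E).
Proof.
move=> oU; apply: open_measurable_R3.
by apply: open_comp => // p _; exact: vec3_continuous.
Qed.

Lemma measurable_vec3_closed (K : set 'rV[R]_3) : closed K ->
  measurable (vec3 @^-1` K : set E).
Proof.
move=> cK.
have -> : vec3 @^-1` K = ~` (vec3 @^-1` (~` K)) by rewrite preimage_setC setCK.
apply: measurableC.
by apply: measurable_vec3; rewrite openC.
Qed.

Lemma compact_closed_rV (K : set 'rV[R]_3) : compact K -> closed K.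
Proof. by apply: compact_closed; exact: norm_hausdorff. Qed.

Lemma measurable_vec3_compact (K : set 'rV[R]_3) : compact K ->
  measurable (vec3 @^-1` K : set E).
Proof. by move=> /compact_closed_rV; exact: measurable_vec3_closed. Qed.

Lemma coord_le_norm (x : 'rV[R]_3) i : `|x 0 i| <= `|x|.
Proof.
rewrite [leRHS]/Num.Def.normr/= mx_normrE.
exact: (le_bigmax _ (fun ij => `|x ij.1 ij.2|) (0, i)).
Qed.

Lemma vol_box (a b : 'rV[R]_3) : (forall i, a 0 i <= b 0 i) ->
  vol (vec3 @^-1` [set x | forall i, a 0 i <= x 0 i <= b 0 i]) =
  (\prod_i (b 0 i - a 0 i))%:E.
Proof.
move=> ab.
rewrite (_ : _ @^-1` _ = (`[a 0 0, b 0 0] `*` `[a 0 1, b 0 1])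
   `*` `[a 0 (1+1), b 0 (1+1)]); last first.
  apply/seteqP; split=> p /=; have [v0 v1 v2] := vec3E p; rewrite !in_itv/=.
    by move=> h; rewrite -v0 -v1 -v2 !h.
  by move=> [[h0 h1] h2]; apply: ord3P; rewrite ?v0 ?v1 ?v2.
rewrite product_measure1E//=; last exact: measurableX.
rewrite (product_measure1E leb leb)//=.
rewrite !lebesgue_measure_itv/= !lte_fin.
have len i :
  (if a 0 i < b 0 i then ((b 0 i)%:E - (a 0 i)%:E)%E else 0%E)
   = (b 0 i - a 0 i)%:E.
  case: ifPn => //; rewrite -leNgt => ba.
  by rewrite (@le_anti _ _ (a 0 i) (b 0 i)) ?ab ?subrr.
rewrite !len -!EFinM !big_ord_recl big_ord0 mulr1 mulrA.
have -> : lift ord0 ord0 = 1 :> 'I_3 by exact: val_inj.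
by have -> : lift ord0 (lift ord0 ord0) = 1 + 1 :> 'I_3 by exact: val_inj.
Qed.

Lemma box_compact (a b : 'rV[R]_3) :
  compact [set x : 'rV[R]_3 | forall i, a 0 i <= x 0 i <= b 0 i].
Proof.
have := @rV_compact R 3 (fun i => `[a 0 i, b 0 i]%classic)
  (fun i => @segment_compact _ _ _).
congr compact; apply/seteqP; split=> x /= h i; have := h i;
  by rewrite in_itv.
Qed.

(** A compact set is bounded, hence contained in a box. *)
Lemma vol_compact_fin (K : set 'rV[R]_3) : compact K ->
  (vol (vec3 @^-1` K) < +oo)%E.
Proof.
move=> cK; have [M [_ MK]] := compact_bounded cK.
pose c : R := Num.max M 0 + 1.
have Mc : M < c by rewrite ltr_pwDr// le_max lexx.
have c0 : 0 <= c by rewrite addr_ge0// le_max lexx orbT.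
pose a : 'rV[R]_3 := const_mx (- c); pose b : 'rV[R]_3 := const_mx c.
have ab i : a 0 i <= b 0 i by rewrite !mxE ge0_cp.
pose box := [set x : 'rV[R]_3 | forall i, a 0 i <= x 0 i <= b 0 i].
apply: (@le_lt_trans _ _ (vol (vec3 @^-1` box))); last by rewrite vol_box// ltry.
apply: le_measure.
- by apply/mem_set; exact: measurable_vec3_compact.
- by apply/mem_set; have := measurable_vec3_compact (@box_compact a b); exact.
- move=> p /= Kp i; rewrite [a 0 i]mxE [b 0 i]mxE -ler_norml.
  by apply: le_trans (coord_le_norm (vec3 p) i) _; exact: MK.
Qed.

Lemma continuous_on_measurable (U K : set 'rV[R]_3) (f : 'rV[R]_3 -> R) :
  open U -> continuous_on U f -> compact K -> K `<=` U ->
  measurable_fun (vec3 @^-1` K : set E) (f \o vec3).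
Proof.
move=> oU cf cK KU; apply: (@open_continuous_measurable _ _ _ E vec3 f U) => //.
- exact: measurable_vec3.
- exact: measurable_vec3_compact.
- by move=> p; exact: KU.
Qed.

Lemma continuous_on_integrable (U K : set 'rV[R]_3) (f : 'rV[R]_3 -> R) :
  open U -> continuous_on U f -> compact K -> K `<=` U ->
  vol.-integrable (vec3 @^-1` K) (EFin \o (f \o vec3)).
Proof.
move=> oU cf cK KU.
have [M M0 fM] := continuous_on_compact_bounded cK KU cf.
apply: (@bounded_integrable _ _ _ _ _ _ M).
- exact: measurable_vec3_compact.
- exact: vol_compact_fin.
- exact: continuous_on_measurable cf cK KU.
- by move=> p; exact: fM.
Qed.

End Space.

Section MeanBound.
Context d (X : measurableType d) (R : realType).
Variable mu : {measure set X -> \bar R}.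

(** The weight is the density when the rate of a material integral is compared
    with the mass of the part, and 1 for the means over a cube. *)
Lemma weighted_mean_bound (D : set X) (w f : X -> R) (c eps : R) :
  measurable D -> mu.-integrable D (EFin \o w) ->
  mu.-integrable D (EFin \o (fun x => w x * f x)) ->
  (forall x, D x -> 0 <= w x) -> (forall x, D x -> `|f x - c| <= eps) ->
  `|\int[mu]_(x in D) (w x * f x) - c * \int[mu]_(x in D) w x| <=
    eps * \int[mu]_(x in D) w x.
Proof.
move=> mD iw iwf w0 fc; rewrite -!RintegralZl//.
have icw k : mu.-integrable D (EFin \o (fun x => k * w x)).
  by have := integrableZl mD k iw; exact.
have iB : mu.-integrable D (EFin \o (fun x => w x * f x - c * w x)).
  by have := integrableB mD iwf (icw c); exact.
rewrite -RintegralB//; apply: le_trans (le_normr_Rintegral mD iB) _.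
apply: le_Rintegral => //; first by have := integrable_norm iB; exact.
move=> x Dx; rewrite [c * _]mulrC -mulrBr normrM [`|w x|]ger0_norm ?w0//.
by rewrite mulrC ler_wpM2r ?w0 ?fc.
Qed.

End MeanBound.

(** * Images of weighted measures *)

Section WeightedImage.
Local Open Scope ereal_scope.
Context d1 d2 (X : measurableType d1) (Y : measurableType d2) (R : realType).
Variable mu : {measure set X -> \bar R}.

Import HBNNSimple.

(** The image by g of the measure of density w on K. The formula for integrals
    follows from the one for sets through simple functions and monotone
    convergence. *)
Lemma weighted_image_measure (K : set X) (w : X -> R) (g : X -> Y) :
  measurable K -> measurable_fun K w -> (forall x, K x -> (0 <= w x)%R) ->
  measurable_fun K g ->
  exists nu : {measure set Y -> \bar R},
    (forall A, measurable A -> nu A = \int[mu]_(x in K `&` g @^-1` A) (w x)%:E) /\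
    (forall f : Y -> \bar R, measurable_fun setT f -> (forall y, 0 <= f y) ->
       \int[nu]_y f y = \int[mu]_(x in K) ((w x)%:E * f (g x))).
Proof.
move=> mK mw w0 mg.
pose nu0 A := \int[mu]_(x in K `&` g @^-1` A) (w x)%:E.
have nu00 : nu0 set0 = 0.
  by rewrite /nu0 preimage_set0 setI0 integral_set0.
have nu0_ge0 A : 0 <= nu0 A
  by apply: integral_ge0 => x [Kx _]; rewrite lee_fin; exact: w0.
have nu0_sigma : semi_sigma_additive nu0.
  move=> F mF tF mUF; rewrite /nu0 preimage_bigcup setI_bigcupr.
  rewrite ge0_integral_bigcup.
  - by apply: is_cvg_ereal_nneg_natsum_cond => n _ _; exact: nu0_ge0.
  - by move=> k; exact: mg.
  - apply/measurable_EFinP; apply: measurable_funS mK _ mw.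
    by move=> x [k _ []].
  - by move=> x [k _ []] Kx _; rewrite lee_fin; exact: w0.
  - apply/trivIsetP => i j _ _ ij.
    move/trivIsetP : tF => /(_ i j Logic.I Logic.I ij) Fij.
    by rewrite setIACA setIid -preimage_setI Fij preimage_set0 setI0.
pose nuM := isMeasure.Build _ _ _ nu0 nu00 nu0_ge0 nu0_sigma.
pose nu : {measure set Y -> \bar R} := HB.pack nu0 nuM.
exists nu; split=> // f mf f0.
have nuE A : measurable A -> \int[nu]_y (\1_A y)%:E =
    \int[mu]_(x in K) ((w x)%:E * (\1_A (g x))%:E).
  move=> mA; rewrite integral_indic// setIT -[LHS]/(nu0 A) /nu0 integral_mkcondr.
  by apply: eq_integral => x xK; rewrite epatch_indic/= !indicE.
have mwg (h : Y -> \bar R) : measurable_fun setT h ->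
    measurable_fun K (fun x => (w x)%:E * h (g x)).
  move=> mh; apply: emeasurable_funM; first exact/measurable_EFinP.
  by apply: (measurable_comp measurableT).
pose f_ := nnsfun_approx measurableT mf.
have f_cvg y : EFin \o f_^~ y @ \oo --> f y by apply: cvg_nnsfun_approx.
have mf_ n : measurable_fun setT (EFin \o f_ n : Y -> \bar R).
  exact/measurable_EFinP.
transitivity (limn (fun n => \int[nu]_y (f_ n y)%:E)).
  rewrite -monotone_convergence//.
  - by apply: eq_integral => y _; apply/esym/cvg_lim => //; exact: f_cvg.
  - by move=> n y _; rewrite lee_fin.
  - by move=> y _ m n mn; rewrite lee_fin; exact/lefP/nd_nnsfun_approx.
rewrite [X in limn X](_ : _ =
    (fun n => \int[mu]_(x in K) ((w x)%:E * (f_ n (g x))%:E))); last first.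
  apply/funext => n.
  under eq_integral do rewrite fimfunE -fsumEFin//.
  rewrite ge0_integral_fsum//; last 2 first.
  - by move=> r; exact/measurable_EFinP/measurable_funM.
  - by move=> r y _; rewrite EFinM nnfun_muleindic_ge0.
  transitivity (\int[mu]_(x in K) (\sum_(r \in range (f_ n))
      ((w x)%:E * (r%:E * (\1_(f_ n @^-1` [set r]) (g x))%:E)))); last first.
    apply: eq_integral => x xK; rewrite -ge0_mule_fsumr; last first.
      by move=> r; exact: nnfun_muleindic_ge0.
    congr (_ * _); rewrite [in RHS]fimfunE -fsumEFin//.
  rewrite ge0_integral_fsum//; last 2 first.
  - move=> r; apply: (mwg (fun y => r%:E * (\1_(f_ n @^-1` [set r]) y)%:E)).
    exact/measurable_EFinP/measurable_funM.
  - move=> r x Kx; apply: mule_ge0; first by rewrite lee_fin; exact: w0.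
    exact: nnfun_muleindic_ge0.
  apply: eq_fsbigr => r rf.
  have r0 : (0 <= r)%R by move: rf; rewrite inE => -[y _ <-].
  under eq_integral do rewrite EFinM.
  under [RHS]eq_integral do rewrite muleCA.
  rewrite ge0_integralZl_EFin//; last exact/measurable_EFinP.
  rewrite ge0_integralZl_EFin//.
  - by rewrite nuE.
  - by move=> x Kx; apply: mule_ge0; [rewrite lee_fin; exact: w0|rewrite lee_fin].
  - by apply: (mwg (fun y => (\1_(f_ n @^-1` [set r]) y)%:E)); exact/measurable_EFinP.
rewrite -(monotone_convergence mu mK).
- apply: eq_integral => x /[!inE] Kx; apply/cvg_lim => //.
  by apply: cvgeZl => //; exact: f_cvg.
- by move=> n; apply: (mwg (fun y => (f_ n y)%:E)); exact: mf_.
- by move=> n x Kx; apply: mule_ge0; [rewrite lee_fin; exact: w0|rewrite lee_fin].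
- move=> x Kx m n mn; apply: lee_wpmul2l; first by rewrite lee_fin; exact: w0.
  by rewrite lee_fin; exact/lefP/nd_nnsfun_approx.
Qed.

(** Two such images that agree on a generating pi-system are equal, whence the
    equality of the integrals. The maps g1 and g2 will be inverse motions at
    two times, and the pi-system that of the closed sets of particles. *)
Lemma eq_weighted_image (G : set (set Y)) (K1 K2 : set X) (w1 w2 : X -> R)
    (g1 g2 : X -> Y) (f : Y -> \bar R) :
  @measurable _ Y = <<s G >> -> setI_closed G -> G setT ->
  measurable K1 -> measurable_fun K1 w1 -> (forall x, K1 x -> (0 <= w1 x)%R) ->
  measurable_fun K1 g1 ->
  measurable K2 -> measurable_fun K2 w2 -> (forall x, K2 x -> (0 <= w2 x)%R) ->
  measurable_fun K2 g2 ->
  \int[mu]_(x in K1) (w1 x)%:E < +oo ->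
  (forall A, G A -> \int[mu]_(x in K1 `&` g1 @^-1` A) (w1 x)%:E =
                    \int[mu]_(x in K2 `&` g2 @^-1` A) (w2 x)%:E) ->
  measurable_fun setT f -> (forall y, 0 <= f y) ->
  \int[mu]_(x in K1) ((w1 x)%:E * f (g1 x)) =
  \int[mu]_(x in K2) ((w2 x)%:E * f (g2 x)).
Proof.
move=> mG IG GT mK1 mw1 w10 mg1 mK2 mw2 w20 mg2 fin1 eqG mf f0.
have [nu1 [nu1E int1]] := weighted_image_measure mK1 mw1 w10 mg1.
have [nu2 [nu2E int2]] := weighted_image_measure mK2 mw2 w20 mg2.
rewrite -int1// -int2//; apply: eq_measure_integral => A mA _.
have GM B : G B -> measurable B by rewrite mG => GB; exact: sub_sigma_algebra.
apply: (measure_unique G (fun=> setT)) => //.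
- by apply/seteqP; split=> // y _; exists 0%N.
- by move=> B GB; rewrite [LHS]nu1E ?[RHS]nu2E//; [exact: eqG|exact: GM..].
- by move=> _; rewrite nu1E// preimage_setT setIT.
Qed.

End WeightedImage.

(** * Motion and transport of mass *)

Section Kinematics.
Context {R : realType}.
Local Notation E := (measurableTypeR R * measurableTypeR R * measurableTypeR R)%type.
Local Notation leb := (@lebesgue_measure R).
Local Notation vol := ((leb \x leb) \x leb)%E.

Context (T : set R) (Omega : set 'rV[R]_3) (u : R -> 'rV[R]_3 -> 'rV[R]_3).

Lemma bodyP t x : body Omega u t x ->
  Omega (particle Omega u t x) /\ motion u t (particle Omega u t x) = x.
Proof.
move=> [X OX mX]; rewrite /particle; case: xgetP => [Y _ [OY mY]//|].
by move=> /(_ X)[].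
Qed.

Hypothesis hu : regular_motion Omega u T.

(** Injectivity of the motion makes the particle chosen at a place unique. *)
Lemma motionK t X : T t -> Omega X -> particle Omega u t (motion u t X) = X.
Proof.
move=> Tt OX; have [_ [_ /(_ t Tt)[mi _ _ _]]] := hu.
have bX : body Omega u t (motion u t X) by exists X.
by have [OY mY] := bodyP bX; apply: mi; rewrite ?inE.
Qed.

Lemma motion_continuous t : T t -> continuous_on Omega (motion u t).
Proof.
move=> Tt X OX; have [[_ [cu _]] _] := hu.
by apply: continuousD; [exact: cvg_id|exact: continuous_on_slice cu Tt X OX].
Qed.

Lemma particle_continuous t : T t ->
  continuous_on (body Omega u t) (particle Omega u t).
Proof. by move=> Tt; have [_ [_ /(_ t Tt)[]]] := hu. Qed.

Lemma body_open t : T t -> open (body Omega u t).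
Proof. by move=> Tt; have [_ [_ /(_ t Tt)[]]] := hu. Qed.

Lemma velocity_motion t X : T t -> Omega X ->
  velocity Omega u t (motion u t X) = derive1 (u ^~ X) t.
Proof. by move=> Tt OX; rewrite /velocity motionK. Qed.

Lemma image_sub_body t P : P `<=` Omega -> motion u t @` P `<=` body Omega u t.
Proof. exact: image_subset. Qed.

Lemma image_compact t P : T t -> compact P -> P `<=` Omega ->
  compact (motion u t @` P).
Proof.
move=> Tt cP PO; apply: continuous_compact => //.
apply: continuous_in_subspaceT => x; rewrite inE => /PO Ox.
exact: motion_continuous.
Qed.

Lemma image_setI t P A : T t -> P `<=` Omega ->
  motion u t @` (P `&` A) =
  motion u t @` P `&` particle Omega u t @^-1` A.
Proof.
move=> Tt PO; apply/seteqP; split=> [_ [X [PX AX] <-]|_ [[X PX <-]]] /=.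
  by split; [exists X|rewrite /= motionK//; exact: PO].
by rewrite /= motionK//; [exists X|exact: PO].
Qed.

(** Row vectors carry no canonical measurable structure; closed sets are taken
    as generators because their traces on a compact part are again parts, to
    which conservation of mass applies. *)
Definition borel := g_sigma_algebraType (@closed 'rV[R]_3).

(** The particles of P that lie in a closed set A form the compact part
    P `&` A, so that the corresponding places form a compact set. *)
Lemma measurable_particle t P : T t -> compact P -> P `<=` Omega ->
  measurable_fun (vec3 @^-1` (motion u t @` P) : set E)
    (particle Omega u t \o vec3 : E -> borel).
Proof.
move=> Tt cP PO; apply: (@measurability _ _ E borel _ _ (@closed 'rV[R]_3) erefl).
move=> _ [A cA <-].
rewrite -[X in measurable X]/(vec3 @^-1`
  (motion u t @` P `&` particle Omega u t @^-1` A)) -image_setI//.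
apply: measurable_vec3_compact; apply: image_compact => //.
- by apply: compact_closedI.
- by move=> X [/PO].
Qed.

Lemma measurable_borel_continuous (f : 'rV[R]_3 -> R) (U A : set 'rV[R]_3) :
  open U -> continuous_on U f -> compact A -> A `<=` U ->
  measurable_fun (A : set borel) (f : borel -> R).
Proof.
move=> oU cf cA AU.
have mopen (V : set 'rV[R]_3) : open V -> measurable (V : set borel).
  move=> oV; rewrite -[V]setCK; apply: measurableC.
  by apply: sub_sigma_algebra; exact: open_closedC.
apply: (@open_continuous_measurable _ _ _ borel id f U) => //.
by apply: sub_sigma_algebra; exact: compact_closed_rV.
Qed.

Hypotheses (openT : open T) (intervalT : is_interval T)
  (openOmega : open Omega).
Variable rho : R -> 'rV[R]_3 -> R.
Hypotheses (rho_ge0 : forall t x, T t -> body Omega u t x -> 0 <= rho t x)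
  (hrho : forall t, T t -> continuous_on (body Omega u t) (rho t))
  (hmass : mass_conservation T Omega u rho).

(** The mass of a part has zero derivative on the interval T. *)
Lemma mass_constant P s t : compact P -> P `<=` Omega -> T s -> T t ->
  volume_integral (motion u s @` P) (rho s) =
  volume_integral (motion u t @` P) (rho t).
Proof.
move=> cP PO Ts Tt.
have [x xst|c _ /eqP] := @MVT_between _
  (fun s => volume_integral (motion u s @` P) (rho s)) (fun=> 0) s t.
  apply: hmass => //; have /orP[ts|st] := le_total t s.
    by apply: (intervalT Tt Ts); move: xst; rewrite min_r// max_l.
  by apply: (intervalT Ts Tt); move: xst; rewrite min_l ?max_r.
by rewrite mul0r subr_eq0 => /eqP.
Qed.

Lemma body_integrable t P f : T t -> compact P -> P `<=` Omega ->
  continuous_on (body Omega u t) f ->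
  vol.-integrable (vec3 @^-1` (motion u t @` P)) (EFin \o (f \o vec3)).
Proof.
move=> Tt cP PO cf; apply: continuous_on_integrable cf _ _.
- exact: body_open.
- exact: image_compact.
- exact: image_sub_body.
Qed.

(** The integral of a material quantity against the mass of a part does not
    depend on the time at which the part is observed. As the comparison of
    image measures is about nonnegative functions, a constant M that bounds
    |phi| on P is added to phi, and its contribution, M times the mass, is the
    same at both times. *)
Lemma volume_integral_transport (phi : 'rV[R]_3 -> R) P s t :
  compact P -> P `<=` Omega -> T s -> T t -> continuous_on Omega phi ->
  volume_integral (motion u s @` P)
    (fun x => rho s x * phi (particle Omega u s x)) =
  volume_integral (motion u t @` P)
    (fun x => rho t x * phi (particle Omega u t x)).
Proof.
move=> cP PO Ts Tt cphi.
have [M M0 phiM] := continuous_on_compact_bounded cP PO cphi.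
pose psi : borel -> \bar R := (fun y => (phi y + M)%:E) \_ P.
have mP : measurable (P : set borel).
  by apply: sub_sigma_algebra; exact: compact_closed_rV.
have mpsi : measurable_fun setT psi.
  apply: (measurable_restrictT (fun y : borel => (phi y + M)%:E) mP).1.
  apply/measurable_EFinP.
  apply: (@measurable_borel_continuous (fun y => phi y + M) Omega) => //.
  by move=> X OX; apply: continuousD; [exact: cphi|exact: cst_continuous].
have psi0 y : (0 <= psi y)%E.
  rewrite /psi patchE; case: ifPn => //; rewrite inE => Py; rewrite lee_fin.
  by rewrite -lerBlDr sub0r; have := phiM _ Py; rewrite ler_norml => /andP[].
have crp r : T r -> continuous_on (body Omega u r)
    (fun x => rho r x * phi (particle Omega u r x)).
  move=> Tr x bx; apply: continuousM; first exact: (hrho Tr).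
  apply: (@cvg_comp _ _ _ (particle Omega u r) phi _
    (nbhs (particle Omega u r x))); first exact: particle_continuous.
  by apply: cphi; have [] := bodyP bx.
have key r : T r ->
    (\int[vol]_(p in vec3 @^-1` (motion u r @` P))
      ((rho r (vec3 p))%:E * psi (particle Omega u r (vec3 p))))%E =
    (volume_integral (motion u r @` P)
      (fun x => rho r x * phi (particle Omega u r x)) +
     M * volume_integral (motion u r @` P) (rho r))%:E.
  move=> Tr.
  have mK : measurable (vec3 @^-1` (motion u r @` P) : set E).
    by apply: measurable_vec3_compact; exact: image_compact.
  have i1 := body_integrable Tr cP PO (crp r Tr).
  have i2 := body_integrable Tr cP PO (hrho Tr).
  have i3 : vol.-integrable (vec3 @^-1` (motion u r @` P))
      (EFin \o (fun p => M * rho r (vec3 p))).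
    have := integrableZl mK M i2; exact.
  rewrite /volume_integral -RintegralZl// -RintegralD//.
  rewrite /Rintegral fineK.
    apply: eq_integral => p; rewrite inE /= => -[X PX mX].
    rewrite /psi patchE -mX motionK//; last exact: PO.
    by rewrite mem_set//= -EFinM mulrDr [M * _]mulrC.
  by apply: integrable_fin_num => //; have := integrableD mK i1 i3; exact.
have mass r A : T r -> closed A ->
    (\int[vol]_(p in (vec3 @^-1` (motion u r @` P)) `&`
       (particle Omega u r \o vec3) @^-1` A) (rho r (vec3 p))%:E)%E =
    (volume_integral (motion u r @` (P `&` A)) (rho r))%:E.
  move=> Tr cA; rewrite (_ : _ `&` _ = vec3 @^-1` (motion u r @` (P `&` A))).
    2: by rewrite image_setI.
  rewrite /volume_integral /Rintegral fineK//.
  apply: integrable_fin_num.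
    apply: measurable_vec3_compact; apply: image_compact => //.
      exact: compact_closedI.
    by move=> X [/PO].
  apply: body_integrable (hrho Tr) => //; first exact: compact_closedI.
  by move=> X [/PO].
have eqE : (volume_integral (motion u s @` P)
      (fun x => rho s x * phi (particle Omega u s x)) +
     M * volume_integral (motion u s @` P) (rho s))%:E =
   (volume_integral (motion u t @` P)
      (fun x => rho t x * phi (particle Omega u t x)) +
     M * volume_integral (motion u t @` P) (rho t))%:E.
  rewrite -(key s Ts) -(key t Tt).
  refine (@eq_weighted_image _ _ E borel _ vol (@closed 'rV[R]_3) _ _ (rho s \o vec3)
    (rho t \o vec3) (particle Omega u s \o vec3) (particle Omega u t \o vec3)
    psi _ _ _ _ _ _ _ _ _ _ _ _ _ _ _).
  - by [].
  - by move=> A B cA cB; exact: closedI.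
  - exact: closedT.
  - by apply: measurable_vec3_compact; exact: image_compact.
  - apply: continuous_on_measurable (hrho Ts) _ _; [exact: body_open|
      exact: image_compact|exact: image_sub_body].
  - by move=> p Kp; apply: rho_ge0 => //; exact: image_sub_body Kp.
  - exact: measurable_particle.
  - by apply: measurable_vec3_compact; exact: image_compact.
  - apply: continuous_on_measurable (hrho Tt) _ _; [exact: body_open|
      exact: image_compact|exact: image_sub_body].
  - by move=> p Kp; apply: rho_ge0 => //; exact: image_sub_body Kp.
  - exact: measurable_particle.
  - by have := mass s setT Ts closedT; rewrite preimage_setT setIT => ->; rewrite ltry.
  - move=> A cA; rewrite !mass//; congr EFin; apply: mass_constant => //.
      exact: compact_closedI.
    by move=> X [/PO].
  - exact: mpsi.
  - exact: psi0.
have := EFin_inj eqE.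
by rewrite (mass_constant cP PO Ts Tt) => /addIr.
Qed.

End Kinematics.

(** * Rate of change of an integral over a moving part *)

Section Rate.
Context {R : realType}.
Context (T : set R) (Omega : set 'rV[R]_3) (u : R -> 'rV[R]_3 -> 'rV[R]_3).
Hypothesis hu : regular_motion Omega u T.
Hypotheses (openT : open T) (intervalT : is_interval T)
  (openOmega : open Omega).
Variable rho : R -> 'rV[R]_3 -> R.
Hypotheses (rho_ge0 : forall t x, T t -> body Omega u t x -> 0 <= rho t x)
  (hrho : forall t, T t -> continuous_on (body Omega u t) (rho t))
  (hmass : mass_conservation T Omega u rho).

Lemma continuous_on_particle (phi : 'rV[R]_3 -> R) t : T t ->
  continuous_on Omega phi ->
  continuous_on (body Omega u t) (fun x => phi (particle Omega u t x)).
Proof.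
move=> Tt cphi x bx; apply: (@cvg_comp _ _ _ (particle Omega u t) phi _
    (nbhs (particle Omega u t x))); first exact: (particle_continuous hu Tt).
by apply: cphi; have [] := bodyP bx.
Qed.

(** Between the times t and s = t + h, the integrals of F(s, .) and of F(t, .)
    are both written over the region occupied at time s, by transport. Their
    difference is then the integral of F(s, X) - F(t, X), which the mean value
    theorem compares with c h. *)
Lemma material_rate_bound (F : R -> 'rV[R]_3 -> R) P t (c eps g : R) :
  compact P -> P `<=` Omega -> T t ->
  (forall s, T s -> continuous_on Omega (F s)) ->
  (forall s X, T s -> Omega X -> derivable (F ^~ X) s 1) ->
  (\forall s \near t, forall X, P X -> `|derive1 (F ^~ X) s - c| <= eps) ->
  is_derive t (1 : R) (fun s => volume_integral (motion u s @` P)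
    (fun x => rho s x * F s (particle Omega u s x))) g ->
  `|g - c * volume_integral (motion u t @` P) (rho t)| <=
    eps * volume_integral (motion u t @` P) (rho t).
Proof.
move=> cP PO Tt cF dF Fc [dG <-].
set G := fun s => _ in dG *.
set m := volume_integral (motion u t @` P) (rho t).
apply: (@cvg_norm_le _ _ (0 : R)^' _ _ _ _ _ dG).
have [d /= d0 dP] : exists2 d : R, 0 < d & forall s, `|t - s| < d ->
    T s /\ forall X, P X -> `|derive1 (F ^~ X) s - c| <= eps.
  have /nbhs_ballP[d /= d0 dP] : nbhs t (T `&` [set s | forall X, P X ->
      `|derive1 (F ^~ X) s - c| <= eps]).
    by apply: filterI => //; exact: open_nbhs_nbhs.
  by exists d => // s /dP.
near=> h.
have h0 : h != 0 by near: h; exact: nbhs_dnbhs_neq.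
have hd : `|h| < d by near: h; exact: dnbhs0_lt.
set s := h *: 1 + t; have sE : s = h + t by rewrite /s scaler1.
have Ts : T s by apply: (dP _ _).1; rewrite sE opprD addrCA subrr addr0 normrN.
have incr X : P X -> `|F s X - F t X - c * h| <= eps * `|h|.
  move=> PX.
  have btw x : Num.min s t <= x <= Num.max s t -> `|t - x| < d.
    move=> xst; apply: le_lt_trans hd.
    move: xst; rewrite sE; have [h1|h1] := leP 0 h.
      rewrite min_r ?lerDr// max_l ?lerDr// => /andP[x1 x2].
      by rewrite (ger0_norm h1) distrC ger0_norm; lra.
    rewrite min_l ?max_r ?gerDr ?(ltW h1)// => /andP[x1 x2].
    by rewrite (ltr0_norm h1) ger0_norm; lra.
  have [|xi xst ->] := @MVT_between _ (F ^~ X) (fun x => derive1 (F ^~ X) x) s t.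
    move=> x /btw/dP[Tx _]; rewrite derive1E; apply: derivableP; apply: dF => //.
    exact: PO.
  have -> : s - t = h by rewrite sE addrK.
  rewrite -mulrBl normrM ler_wpM2r//.
  by have [_] := dP _ (btw _ xst); exact.
have int (f : 'rV[R]_3 -> R) : continuous_on (body Omega u s) f ->
    ((@lebesgue_measure R \x @lebesgue_measure R) \x @lebesgue_measure R)%E.-integrable
    (vec3 @^-1` (motion u s @` P)) (EFin \o (fun p => rho s (vec3 p) * f (vec3 p))).
  move=> cf.
  apply: (@body_integrable _ T Omega u hu s P (fun x => rho s x * f x)) => //.
  by move=> x bx; apply: continuousM; [exact: (hrho Ts)|exact: cf].
have mK : measurable (vec3 @^-1` (motion u s @` P) :
    set (measurableTypeR R * measurableTypeR R * measurableTypeR R)%type).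
  by apply: measurable_vec3_compact; exact: (image_compact hu).
have cFp r : T r ->
    continuous_on (body Omega u s) (fun x => F r (particle Omega u s x)).
  by move=> Tr; exact: continuous_on_particle Ts (cF _ Tr).
have GsE : G s - G t = volume_integral (motion u s @` P) (fun x =>
    rho s x * (F s (particle Omega u s x) - F t (particle Omega u s x))).
  rewrite /G -(volume_integral_transport hu intervalT openOmega rho_ge0
    hrho hmass cP PO Ts Tt (cF _ Tt)).
  rewrite /volume_integral -RintegralB//.
  - by apply: eq_Rintegral => p _; rewrite mulrBr.
  - exact: int (cFp s Ts).
  - exact: int (cFp t Tt).
have bound : `|G s - G t - c * h * m| <= eps * `|h| * m.
  rewrite GsE /m -(mass_constant intervalT hmass cP PO Ts Tt).
  apply: weighted_mean_bound => //.
  - exact: (body_integrable hu Ts cP PO (hrho Ts)).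
  - apply: (int (fun x => F s (particle Omega u s x) - F t (particle Omega u s x))).
    by move=> x bx; apply: continuousB; [exact: cFp|exact: cFp].
  - by move=> p Kp; apply: rho_ge0 => //; exact: image_sub_body Kp.
  - move=> p /= [X PX <-]; rewrite (motionK hu)//; last exact: PO.
    exact: incr.
rewrite /= [leLHS](_ : _ = `|h|^-1 * `|G s - G t - c * h * m|).
  rewrite ler_pdivrMl ?normr_gt0//; apply: le_trans bound _.
  by rewrite mulrA [eps * _]mulrC.
rewrite -normfV -normrM mulrBr; congr (`|_ - _|).
by field.
Unshelve. all: by end_near. Qed.

End Rate.

(** * Cubes and their faces *)

Section Cube.
Context {R : realType}.
Implicit Types (x y : 'rV[R]_3) (d : R) (i j : 'I_3) (b : bool) (p : R * R).

(** The coordinate i and the two coordinates that follow it cyclically, which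
    form a direct frame with it. *)
Lemma ord3_shiftP i (P : 'I_3 -> Prop) :
  P i -> P (i + 1) -> P (i + 2) -> forall j, P j.
Proof.
have two : 2 = 1 + 1 :> 'I_3 by exact: val_inj.
have e1 : 1 + 2 = 0 :> 'I_3 by exact: val_inj.
have e2 : 1 + 1 + 1 = 0 :> 'I_3 by exact: val_inj.
have e3 : 1 + 1 + 2 = 1 :> 'I_3 by exact: val_inj.
move: i; apply: ord3P; rewrite ?add0r ?e1 ?e2 ?e3 ?two => *; exact: ord3P.
Qed.

Lemma ord3_shift_neq i :
  [/\ (i + 1 == i) = false, (i + 2 == i) = false & (i + 2 == i + 1) = false].
Proof. by move: i; apply: ord3P. Qed.

Lemma rv_norm_leP y d : 0 <= d -> `|y| <= d <-> forall i, `|y 0 i| <= d.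
Proof.
move=> d0; split=> [yd i|yd]; first exact: le_trans (coord_le_norm y i) yd.
rewrite [leLHS]/Num.Def.normr/= mx_normrE; apply: bigmax_le => // -[k i] _ /=.
by rewrite ord1.
Qed.

Lemma rv_norm_ltP y d : 0 < d -> `|y| < d <-> forall i, `|y 0 i| < d.
Proof.
move=> d0; split=> [yd i|yd]; first exact: le_lt_trans (coord_le_norm y i) yd.
rewrite [ltLHS]/Num.Def.normr/= mx_normrE; apply: bigmax_lt => // -[k i] _ /=.
by rewrite ord1.
Qed.

Lemma cubeP x d y : 0 < d ->
  closed_ball x d y <-> forall i, `|y 0 i - x 0 i| <= d.
Proof.
move=> d0; rewrite closed_ballE// /closed_ball_/= distrC.
by rewrite rv_norm_leP ?ltW//; split=> h i; have := h i; rewrite !mxE.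
Qed.

Lemma cube_compact x d : 0 < d -> compact (closed_ball x d).
Proof.
move=> d0; have := @box_compact R (x - const_mx d) (x + const_mx d).
congr compact; apply/seteqP; split=> y; rewrite /= cubeP// => h i; have := h i;
  by rewrite !mxE ler_distl.
Qed.

Lemma vol_cube x d : 0 < d ->
  ((@lebesgue_measure R \x @lebesgue_measure R) \x @lebesgue_measure R)%E
    (vec3 @^-1` closed_ball x d) = (8 * d ^+ 3)%:E.
Proof.
move=> d0; rewrite (_ : closed_ball x d = [set y : 'rV[R]_3 | forall i,
  (x - const_mx d) 0 i <= y 0 i <= (x + const_mx d) 0 i]).
  rewrite vol_box; last by move=> i; rewrite !mxE; lra.
  congr EFin; under eq_bigr do rewrite !mxE opprD addrACA subrr add0r opprK.
  by rewrite prodr_const card_ord; ring.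
apply/seteqP; split=> y; rewrite /= cubeP// => h i; have := h i;
  by rewrite !mxE ler_distl.
Qed.

Definition sgb b : R := if b then 1 else -1.

(** The faces of the cube come in pairs: the face (i, true) lies on the side of
    increasing i-th coordinate, the face (i, false) on the opposite side. A
    face is parametrized affinely from one of its corners along two edges,
    which are exchanged on the second face of a pair so that the normal points
    outwards on both. *)
Definition face_origin x d i b : 'rV[R]_3 :=
  x + d *: (sgb b *: delta_mx 0 i - delta_mx 0 (i + 1) - delta_mx 0 (i + 2)).

Definition face_edge1 d i b : 'rV[R]_3 :=
  (2 * d) *: delta_mx 0 (i + (if b then 1 else 2)).

Definition face_edge2 d i b : 'rV[R]_3 :=
  (2 * d) *: delta_mx 0 (i + (if b then 2 else 1)).

Definition face x d i b p : 'rV[R]_3 :=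
  face_origin x d i b + p.1 *: face_edge1 d i b + p.2 *: face_edge2 d i b.

(** The parameters that run along the coordinates i + 1 and i + 2. *)
Definition coord1 b p : R := if b then p.1 else p.2.
Definition coord2 b p : R := if b then p.2 else p.1.

Lemma face_coord x d i b p :
  [/\ face x d i b p 0 i - x 0 i = sgb b * d,
      face x d i b p 0 (i + 1) - x 0 (i + 1) = d * (2 * coord1 b p - 1)
    & face x d i b p 0 (i + 2) - x 0 (i + 2) = d * (2 * coord2 b p - 1)].
Proof.
have [n1 n2 n3] := ord3_shift_neq i.
have n1' : (i == i + 1) = false by rewrite eq_sym.
have n2' : (i == i + 2) = false by rewrite eq_sym.
have n3' : (i + 1 == i + 2) = false by rewrite eq_sym.
by case: b; split;
  rewrite !mxE ?eqxx 9?(n1, n2, n3, n1', n2', n3') /= ?mulr0n ?mulr1n; ring.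
Qed.

Lemma face_derive x d i b p v :
  'D_v (face x d i b) p = v.1 *: face_edge1 d i b + v.2 *: face_edge2 d i b.
Proof.
apply/cvg_lim => //; apply: cvg_near_cst; near=> h.
have h0 : h != 0 by near: h; exact: nbhs_dnbhs_neq.
rewrite /face /= -[h *: v.1]/(h * v.1) -[h *: v.2]/(h * v.2).
apply: (scalerI h0); rewrite scalerA mulfV// scale1r.
by apply/rowP => k; rewrite !mxE; ring.
Unshelve. all: by end_near. Qed.

Lemma face_C1 x d i b : C1_on setT (face x d i b).
Proof.
move=> p _; split; last first.
  move=> v; rewrite (_ : 'D_v (face x d i b) = fun=>
    v.1 *: face_edge1 d i b + v.2 *: face_edge2 d i b).
    exact: cst_continuous.
  by apply/funext => q; exact: face_derive.
have dfst : differentiable (fst : R * R -> R) p.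
  by apply: linear_differentiable => q; exact: cvg_fst.
have dsnd : differentiable (snd : R * R -> R) p.
  by apply: linear_differentiable => q; exact: cvg_snd.
apply: differentiableD; first apply: differentiableD => //.
- exact: differentiableZl.
- exact: differentiableZl.
Qed.

Lemma face_normal x d i b p :
  patch_normal (face x d i b) p = (sgb b * (4 * d ^+ 2)) *: delta_mx 0 i.
Proof.
rewrite /patch_normal !face_derive /= !scale1r !scale0r addr0 add0r.
have [n1 n2 n3] := ord3_shift_neq i.
have n1' : (i == i + 1) = false by rewrite eq_sym.
have n2' : (i == i + 2) = false by rewrite eq_sym.
have n3' : (i + 1 == i + 2) = false by rewrite eq_sym.
have a1 : i + 1 + 1 = i + 2 by rewrite -addrA.
have a2 : i + 1 + 2 = i.
  by move: i {n1 n2 n3 n1' n2' n3' a1}; apply: ord3P; exact: val_inj.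
have a3 : i + 2 + 1 = i by rewrite addrAC.
have a4 : i + 2 + 2 = i + 1.
  by move: i {n1 n2 n3 n1' n2' n3' a1 a2 a3}; apply: ord3P; exact: val_inj.
apply/rowP; apply: (@ord3_shiftP i); rewrite /cross /face_edge1 /face_edge2;
  by case: b; rewrite !mxE 9?(a1, a2, a3, a4) ?eqxx
    9?(n1, n2, n3, n1', n2', n3') /= ?mulr0n ?mulr1n; ring.
Qed.

Lemma euclid_norm_delta c i : euclid_norm (c *: delta_mx 0 i : 'rV[R]_3) = `|c|.
Proof.
rewrite /euclid_norm (bigD1 i)//= big1 => [|j ji]; last first.
  by rewrite !mxE eqxx/= (negbTE ji) mulr0 expr0n.
by rewrite !mxE !eqxx addr0 mulr1 sqrtr_sqr.
Qed.

Lemma normr_sgb b : `|sgb b| = 1.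
Proof. by case: b; rewrite /sgb ?normrN normr1. Qed.

Lemma face_area x d i b p : 0 < d ->
  euclid_norm (patch_normal (face x d i b) p) = 4 * d ^+ 2.
Proof.
move=> d0; rewrite face_normal euclid_norm_delta normrM normr_sgb mul1r.
by rewrite ger0_norm// mulr_ge0// exprn_ge0// ltW.
Qed.

Lemma face_unit_normal x d i b p : 0 < d ->
  unit_normal (face x d i b) p = sgb b *: delta_mx 0 i.
Proof.
move=> d0; rewrite /unit_normal face_area// face_normal scalerA; congr (_ *: _).
by rewrite mulrCA mulVf ?mulr1// mulf_neq0// expf_neq0// gt_eqF.
Qed.

End Cube.

Section CubeBoundary.
Context {R : realType}.
Implicit Types (x y : 'rV[R]_3) (d : R) (i j : 'I_3) (b : bool) (p : R * R).

Definition cube_patch x d (k : 'I_(3 + 3)) : R * R -> 'rV[R]_3 :=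
  match fintype.split k with
  | inl i => face x d i true
  | inr i => face x d i false
  end.

Lemma cube_patchE x d k : exists i b, cube_patch x d k = face x d i b.
Proof.
by rewrite /cube_patch; case: fintype.split => i; exists i; [exists true|exists false].
Qed.

Lemma coord_square b p : square p ->
  0 <= coord1 b p <= 1 /\ 0 <= coord2 b p <= 1.
Proof. by case: p => p1 p2 [/=]; rewrite !in_itv/=; case: b. Qed.

Lemma coord_open_square b p : open_square p ->
  0 < coord1 b p < 1 /\ 0 < coord2 b p < 1.
Proof. by case: p => p1 p2 [/=]; rewrite !in_itv/=; case: b. Qed.

Lemma coord_inj b p p' : coord1 b p = coord1 b p' -> coord2 b p = coord2 b p' ->
  p = p'.
Proof. by case: p p' b => p1 p2 [p1' p2'] [] /= -> ->. Qed.

Lemma coord_surj b (s t : R) : exists p, coord1 b p = s /\ coord2 b p = t.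
Proof. by case: b; [exists (s, t)|exists (t, s)]. Qed.

Lemma norm_itv (s d : R) : 0 < d -> 0 <= s <= 1 -> `|d * (2 * s - 1)| <= d.
Proof. by move=> d0 s01; rewrite ler_norml; apply/andP; split; nra. Qed.

Lemma norm_itv_open (s d : R) : 0 < d -> 0 < s < 1 -> `|d * (2 * s - 1)| < d.
Proof. by move=> d0 s01; rewrite ltr_norml; apply/andP; split; nra. Qed.

Lemma norm_sgb b d : 0 < d -> `|sgb b * d : R| = d.
Proof. by move=> d0; rewrite normrM normr_sgb mul1r gtr0_norm. Qed.

Lemma face_cube x d i b p : 0 < d -> square p ->
  closed_ball x d (face x d i b p).
Proof.
move=> d0 sp; apply/cubeP => //; have [f0 f1 f2] := face_coord x d i b p.
have [c1 c2] := coord_square b sp.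
apply: (@ord3_shiftP i); rewrite ?f0 ?f1 ?f2; first by rewrite norm_sgb.
  exact: norm_itv.
exact: norm_itv.
Qed.

(** On the face (i, b), the i-th coordinate is the only one at distance d from
    the centre as long as the parameters are interior; this recovers the face,
    and then the parameters. *)
Lemma face_inj x d i b i' b' p p' : 0 < d -> open_square p -> square p' ->
  face x d i b p = face x d i' b' p' -> (i = i' /\ b = b') /\ p = p'.
Proof.
move=> d0 op sp' fE.
have [f0 f1 f2] := face_coord x d i b p.
have [g0 g1 g2] := face_coord x d i' b' p'.
have [c1 c2] := coord_open_square b op.
have ii' : i = i'.
  suff : forall j, `|face x d i b p 0 j - x 0 j| = d -> i = j.
    by apply; rewrite fE g0 norm_sgb.
  apply: (@ord3_shiftP i) => //; rewrite ?f1 ?f2 => h.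
    by have := norm_itv_open d0 c1; rewrite h ltxx.
  by have := norm_itv_open d0 c2; rewrite h ltxx.
subst i'; have bb' : b = b'.
  move: f0; rewrite fE g0 => /(mulIf (lt0r_neq0 d0)).
  by case: b b' {fE f1 f2 g0 g1 g2 c1 c2} => -[] // h; exfalso;
    move: h; rewrite /sgb; lra.
subst b'; split=> //.
have cancel (s t : R) : d * (2 * s - 1) = d * (2 * t - 1) -> s = t.
  by move=> /(mulfI (lt0r_neq0 d0)) h; lra.
by apply: (@coord_inj b); apply: cancel; rewrite -?f1 -?f2 fE.
Qed.

Lemma cube_boundary x d : 0 < d ->
  closure (closed_ball x d) `\` (closed_ball x d)° =
  \bigcup_k (cube_patch x d k @` square).
Proof.
move=> d0; rewrite interior_closed_ballE//.
have -> : closure (closed_ball x d) = closed_ball x d.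
  by apply/esym/closure_id; exact: closed_ball_closed.
have ballP y : ball x d y <-> forall i, `|y 0 i - x 0 i| < d.
  rewrite -ball_normE /ball_/= distrC rv_norm_ltP//.
  by split=> h i; have := h i; rewrite !mxE.
apply/seteqP; split=> y.
  move=> [yd nyd].
  have {nyd}[i yi] : exists i, `|y 0 i - x 0 i| = d.
    apply: contrapT => ne; apply: nyd; apply/ballP => i.
    rewrite lt_neqAle; apply/andP; split; last by move/cubeP : yd; apply.
    by apply/eqP => h; apply: ne; exists i.
  pose b := 0 <= y 0 i - x 0 i.
  have yib : y 0 i - x 0 i = sgb b * d.
    rewrite -yi /b; have [h|h] := leP 0 (y 0 i - x 0 i).
      by rewrite mul1r ger0_norm.
    by rewrite ltr0_norm// mulN1r opprK.
  have [p [p1 p2]] := coord_surj b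
    (2^-1 * ((y 0 (i + 1) - x 0 (i + 1)) / d + 1))
    (2^-1 * ((y 0 (i + 2) - x 0 (i + 2)) / d + 1)).
  have s01 j : 0 <= 2^-1 * ((y 0 j - x 0 j) / d + 1) <= 1.
    have : `|(y 0 j - x 0 j) / d| <= 1.
      rewrite normrM normfV (gtr0_norm d0) ler_pdivrMr// mul1r.
      by move/cubeP : yd; apply.
    by rewrite ler_norml => /andP[h1 h2]; apply/andP; split; lra.
  have sp : square p.
    move: (s01 (i + 1)) (s01 (i + 2)); rewrite -p1 -p2.
    case: p {p1 p2} => q1 q2; rewrite /square/= => h1 h2.
    by split; rewrite /= in_itv/=; case: (b) h1 h2.
  have fy : face x d i b p = y.
    have [f0 f1 f2] := face_coord x d i b p.
    have xy j : face x d i b p 0 j - x 0 j = y 0 j - x 0 j ->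
      face x d i b p 0 j = y 0 j by move/addIr.
    apply/rowP; apply: (@ord3_shiftP i); apply: xy.
    - by rewrite f0 yib.
    - by rewrite f1 p1; field; rewrite gt_eqF.
    - by rewrite f2 p2; field; rewrite gt_eqF.
  exists (if b then lshift 3 i else rshift 3 i) => //; exists p => //.
  by rewrite -fy /cube_patch; case: (b);
    [rewrite -[lshift 3 i]/(unsplit (inl i)) unsplitK|
     rewrite -[rshift 3 i]/(unsplit (inr i)) unsplitK].
move=> [k _ [p sp <-]]; have [i [b ->]] := cube_patchE x d k.
split; first exact: face_cube.
move/ballP => /(_ i); have [-> _ _] := face_coord x d i b p.
by rewrite norm_sgb// ltxx.
Qed.

Lemma cube_boundary_patches x d : 0 < d ->
  boundary_patches (closed_ball x d) (cube_patch x d).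
Proof.
move=> d0; split.
- exact: cube_boundary.
- move=> k; exists setT; split; [exact: openT|by []|].
  by have [i [b ->]] := cube_patchE x d k; exact: face_C1.
- move=> k l p p' op sp'; rewrite /cube_patch.
  case: (splitP k) => i ki; case: (splitP l) => j lj /(face_inj d0 op sp')
    [[ij]] // _ ->; split=> //; apply: val_inj; rewrite /= ki lj ij //.
- move=> k p op; have [i [b ->]] := cube_patchE x d k.
  rewrite -normr_gt0 face_normal normrZ normrM normr_sgb mul1r mulr_gt0//.
    by rewrite normr_gt0 mulf_neq0// expf_neq0// gt_eqF.
  rewrite normr_gt0; apply/eqP => /rowP/(_ i); rewrite !mxE !eqxx/=.
  by apply/eqP; rewrite oner_eq0.
- move=> k p op; have [i [b ->]] := cube_patchE x d k.
  rewrite face_unit_normal//.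
  have [f0 f1 f2] := face_coord x d i b p.
  have [c1 c2] := coord_open_square b op.
  have [n1 n2 _] := ord3_shift_neq i.
  move: (face x d i b p) f0 f1 f2 => y f0 f1 f2.
  near=> eps.
  have e0 : 0 < eps by near: eps; exact: nbhs_right_gt.
  have ed : eps < d by near: eps; exact: nbhs_right_lt.
  split.
    move/cubeP => /(_ d0 i); rewrite !mxE !eqxx mulr1 addrAC f0.
    rewrite [eps * _]mulrC -mulrDr normrM normr_sgb mul1r gtr0_norm//; lra.
  apply/cubeP => //; apply: (@ord3_shiftP i).
  + rewrite !mxE !eqxx mulr1 addrAC f0 [eps * _]mulrC -mulrBr.
    by rewrite normrM normr_sgb mul1r ger0_norm; lra.
  + rewrite !mxE eqxx n1 /= !mulr0 subr0 f1; apply/ltW; exact: norm_itv_open.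
  + rewrite !mxE eqxx n2 /= !mulr0 subr0 f2; apply/ltW; exact: norm_itv_open.
Unshelve. all: by end_near. Qed.

End CubeBoundary.

Lemma cube_mean (R : realType) (U : set 'rV[R]_3) (f : 'rV[R]_3 -> R) (x : 'rV[R]_3)
    (d eps : R) :
  0 < d -> open U -> continuous_on U f -> closed_ball x d `<=` U ->
  (forall y, closed_ball x d y -> `|f y - f x| <= eps) ->
  `|volume_integral (closed_ball x d) f - f x * (8 * d ^+ 3)| <=
    eps * (8 * d ^+ 3).
Proof.
move=> d0 oU cf xU fx.
have cD := cube_compact (x := x) d0; have mD := measurable_vec3_compact cD.
have iU (g : 'rV[R]_3 -> R) : continuous_on U g ->
    ((@lebesgue_measure R \x @lebesgue_measure R) \x @lebesgue_measure R)%E.-integrable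
    (vec3 @^-1` closed_ball x d) (EFin \o (g \o vec3)).
  by move=> cg; exact: continuous_on_integrable oU cg cD xU.
have vol1 : volume_integral (closed_ball x d) (fun=> 1) = 8 * d ^+ 3.
  by rewrite /volume_integral Rintegral_cst//= vol_cube// mul1r.
have -> : volume_integral (closed_ball x d) f =
    volume_integral (closed_ball x d) (fun y => 1 * f y).
  by apply: eq_Rintegral => p _; rewrite mul1r.
rewrite -vol1; apply: weighted_mean_bound => //.
- by apply: (iU (fun=> 1)) => y _; exact: cst_continuous.
- apply: (iU (fun y => 1 * f y)) => y Uy.
  by apply: continuousM; [exact: cst_continuous|exact: cf].
- by move=> p; exact: fx.
Qed.

(** * Flux through the boundary of a small cube *)

Section Flux.
Context {R : realType}.
Implicit Types (x y : 'rV[R]_3) (d : R) (i j : 'I_3) (b : bool) (p : R * R).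
Local Notation leb := (@lebesgue_measure R).
Local Notation area := (leb \x leb)%E.
Local Notation E2 := (measurableTypeR R * measurableTypeR R)%type.

Lemma square_compact : compact (@square R).
Proof. by apply: compact_setX; exact: segment_compact. Qed.

Lemma measurable_square : measurable (square : set E2).
Proof. by apply: measurableX; exact: measurable_itv. Qed.

Lemma area_square : area (square : set E2) = 1%E.
Proof.
rewrite product_measure1E//= !lebesgue_measure_itv/= lte_fin ltr01.
by rewrite sube0 mule1.
Qed.

Lemma square_integrable (f : R * R -> R) (V : set (R * R)) :
  open V -> square `<=` V -> continuous_on V f ->
  area.-integrable (square : set E2) (EFin \o f).
Proof.
move=> oV sV cf.
have [M M0 fM] := continuous_on_compact_bounded square_compact sV cf.
apply: (@bounded_integrable _ _ _ _ _ _ M).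
- exact: measurable_square.
- by have := ltry (1 : R); rewrite -area_square; exact.
- apply: (@open_continuous_measurable _ _ _ E2 id f V) => //.
    exact: open_measurable_R2.
  exact: measurable_square.
- exact: fM.
Qed.

Lemma square_integrableT (f : R * R -> R) : continuous f ->
  area.-integrable (square : set E2) (EFin \o f).
Proof.
move=> cf; have cfT : continuous_on setT f by move=> p _; exact: cf.
exact: (square_integrable openT (@subsetT _ _) cfT).
Qed.

Lemma fst_square_integrable : area.-integrable (square : set E2) (EFin \o fst).
Proof. by apply: square_integrableT => p; exact: cvg_fst. Qed.

Lemma snd_square_integrable : area.-integrable (square : set E2) (EFin \o snd).
Proof. by apply: square_integrableT => p; exact: cvg_snd. Qed.

Lemma square_integral_cst (c : R) : \int[area]_(p in square) c = c.
Proof.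
rewrite Rintegral_cst//=; last exact: measurable_square.
by rewrite area_square mulr1.
Qed.

(** Fubini, taken in both orders. *)
Lemma square_mean_coord :
  \int[area]_(p in square) p.1 = \int[area]_(p in square) p.2.
Proof.
have msq := measurable_square.
have ifst := fst_square_integrable.
have isnd := snd_square_integrable.
pose f : E2 -> \bar R := (EFin \o fst) \_ square.
pose g : E2 -> \bar R := (EFin \o snd) \_ square.
have f0 p : (0 <= f p)%E.
  rewrite /f patchE; case: ifPn => //; rewrite inE => -[/= + _].
  by rewrite in_itv/= lee_fin => /andP[].
have g0 p : (0 <= g p)%E.
  rewrite /g patchE; case: ifPn => //; rewrite inE => -[/= _].
  by rewrite in_itv/= lee_fin => /andP[].
have mf : measurable_fun setT f.
  apply: (measurable_restrictT (EFin \o fst) msq).1; exact: measurable_int ifst.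
have mg : measurable_fun setT g.
  apply: (measurable_restrictT (EFin \o snd) msq).1; exact: measurable_int isnd.
have fg s : (fun t => f (s, t)) = (fun t => g (t, s)).
  apply/funext => t; rewrite /f /g !patchE; congr (if _ then _ else _).
  by apply/idP/idP; rewrite !inE => -[].
have FG : fubini_F leb f = fubini_G leb g.
  by apply/funext => s; rewrite /fubini_F /fubini_G fg.
rewrite /Rintegral [in LHS]integral_mkcond [in RHS]integral_mkcond -/f -/g.
by rewrite [in LHS]fubini_tonelli1// FG [in RHS]fubini_tonelli2.
Qed.

(** Because the edges are exchanged, points with the same parameters on
    opposite faces do not face each other: their difference has a transversal
    part, proportional to p.1 - p.2. *)
Lemma face_difference (L : {linear 'rV[R]_3 -> R}) x d i p :
  let k := 2 * d * (L (delta_mx 0 (i + 1)) - L (delta_mx 0 (i + 2))) in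
  L (face x d i true p - face x d i false p) =
  2 * d * L (delta_mx 0 i) + k * (p.1 - p.2).
Proof.
have -> : face x d i true p - face x d i false p = (2 * d) *: delta_mx 0 i +
    (2 * d * (p.1 - p.2)) *: (delta_mx 0 (i + 1) - delta_mx 0 (i + 2)).
  apply/rowP => j.
  by rewrite /face /face_origin /face_edge1 /face_edge2 /sgb !mxE /=; ring.
rewrite linearD !linearZ linearB /= -![_ *: _]/(_ * _).
by ring.
Qed.

Lemma face_difference_integrable (c k : R) :
  area.-integrable (square : set E2) (EFin \o (fun p => c + k * (p.1 - p.2))).
Proof.
apply: (@square_integrableT (fun p => c + k * (p.1 - p.2))) => p.
apply: (@continuousD _ _ _ (fun=> c) (fun p => k * (p.1 - p.2))).
  exact: cst_continuous.
apply: (@continuousM _ _ (fun=> k) (fun p => p.1 - p.2)).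
  exact: cst_continuous.
by apply: continuousB; [exact: cvg_fst|exact: cvg_snd].
Qed.

(** The transversal part has mean zero on the square. *)
Lemma face_difference_mean (L : {linear 'rV[R]_3 -> R}) x d i :
  \int[area]_(p in square) L (face x d i true p - face x d i false p) =
  2 * d * L (delta_mx 0 i).
Proof.
have msq := measurable_square.
under eq_Rintegral do rewrite face_difference.
set c := 2 * d * _; set k := 2 * d * _.
have icst : area.-integrable (square : set E2) (EFin \o (fun=> c)).
  by apply: (@square_integrableT (fun=> c)); exact: cst_continuous.
have ifst := fst_square_integrable.
have isnd := snd_square_integrable.
have iB : area.-integrable (square : set E2) (EFin \o (fun p => p.1 - p.2)).
  by have := integrableB msq ifst isnd; exact.
have ikB : area.-integrable (square : set E2) (EFin \o (fun p => k * (p.1 - p.2))).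
  by have := integrableZl msq k iB; exact.
rewrite RintegralD// RintegralZl// RintegralB// square_integral_cst.
by rewrite square_mean_coord subrr mulr0 addr0.
Qed.

Lemma face_integrable (f : 'rV[R]_3 -> R) (U : set 'rV[R]_3) x d i b : 0 < d ->
  open U -> continuous_on U f -> closed_ball x d `<=` U ->
  area.-integrable (square : set E2) (EFin \o (f \o face x d i b)).
Proof.
move=> d0 oU cf xU.
have cface : continuous (face x d i b).
  move=> p; have [df _] := @face_C1 _ x d i b p Logic.I.
  exact: differentiable_continuous.
apply: (@square_integrable _ (face x d i b @^-1` U)).
- by apply: open_comp oU => p _; exact: cface.
- by move=> p sp; apply: xU; exact: face_cube.
- move=> p Up; apply: (@cvg_comp _ _ _ (face x d i b) f _
    (nbhs (face x d i b p))); first exact: cface.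
  exact: cf.
Qed.

(** On each face f is replaced by its expansion f x + L (y - x); the values f x
    cancel, and the mean of the linear part over the pair is known. *)
Lemma face_pair_flux (f : 'rV[R]_3 -> R) (L : {linear 'rV[R]_3 -> R})
    (U : set 'rV[R]_3) x d i (eps : R) : 0 < d ->
  open U -> continuous_on U f -> closed_ball x d `<=` U ->
  (forall y, `|y - x| <= d -> `|f y - f x - L (y - x)| <= eps * d) ->
  `|\int[area]_(p in square) f (face x d i true p) -
    \int[area]_(p in square) f (face x d i false p) -
    2 * d * L (delta_mx 0 i)| <= 2 * eps * d.
Proof.
move=> d0 oU cf xU fL; have msq := measurable_square.
have If b := face_integrable i b d0 oU cf xU.
pose g p := L (face x d i true p - face x d i false p).
have Ig : area.-integrable (square : set E2) (EFin \o g).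
  have -> : g = fun p => 2 * d * L (delta_mx 0 i) + 2 * d *
      (L (delta_mx 0 (i + 1)) - L (delta_mx 0 (i + 2))) * (p.1 - p.2).
    by apply/funext => p; exact: face_difference.
  exact: face_difference_integrable.
rewrite -(face_difference_mean L x d i).
have := RintegralB msq (If true) (If false); rewrite /= => <-.
have IB : area.-integrable (square : set E2) (EFin \o (fun p =>
    f (face x d i true p) - f (face x d i false p))).
  by have := integrableB msq (If true) (If false); exact.
have := RintegralB msq IB Ig; rewrite /= => <-.
have Iall : area.-integrable (square : set E2) (EFin \o (fun p =>
    f (face x d i true p) - f (face x d i false p) - g p)).
  by have := integrableB msq IB Ig; exact.
apply: le_trans (le_normr_Rintegral msq Iall) _.
have -> : 2 * eps * d = \int[area]_(p in (square : set E2)) (2 * eps * d).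
  by rewrite square_integral_cst.
apply: le_Rintegral => //.
- by have := integrable_norm Iall; exact.
- apply: (@square_integrableT (fun=> 2 * eps * d)); exact: cst_continuous.
move=> p sp.
have fb b : `|face x d i b p - x| <= d.
  have : closed_ball x d (face x d i b p) by exact: face_cube.
  by rewrite closed_ballE// /closed_ball_/= distrC.
rewrite (_ : _ - g p = (f (face x d i true p) - f x - L (face x d i true p - x)) -
   (f (face x d i false p) - f x - L (face x d i false p - x))); last first.
  by rewrite /g !linearB /=; ring.
apply: le_trans (ler_normB _ _) _.
by have := lerD (fL _ (fb true)) (fL _ (fb false)); lra.
Qed.

End Flux.

Section CubeFlux.
Context {R : realType}.
Implicit Types (x y : 'rV[R]_3) (d : R) (i j : 'I_3) (b : bool) (p : R * R).
Local Notation leb := (@lebesgue_measure R).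
Local Notation area := (leb \x leb)%E.
Local Notation E2 := (measurableTypeR R * measurableTypeR R)%type.

(** For f y n the component of a field w along n, this is the divergence theorem
    on a small cube: when w is differentiable at x, eps is as small as one likes
    for small d, and the error is o(d^3). The bound is the error eps d on each
    of the six faces, of area 4 d^2. *)
Lemma cube_flux (f : 'rV[R]_3 -> 'rV[R]_3 -> R) (w : 'I_3 -> 'rV[R]_3 -> R)
    (L : 'I_3 -> {linear 'rV[R]_3 -> R}) (U : set 'rV[R]_3) x d (eps : R) :
  0 < d -> open U -> (forall i, continuous_on U (w i)) ->
  closed_ball x d `<=` U ->
  (forall y n, f y n = \sum_i n 0 i * w i y) ->
  (forall i y, `|y - x| <= d -> `|w i y - w i x - L i (y - x)| <= eps * d) ->
  `|surface_integral (cube_patch x d) f -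
    8 * d ^+ 3 * \sum_i L i (delta_mx 0 i)| <= 24 * eps * d ^+ 3.
Proof.
move=> d0 oU cw xU fw wL.
have fE i b p : f (face x d i b p) (unit_normal (face x d i b) p) *
    euclid_norm (patch_normal (face x d i b) p) =
    sgb b * (4 * d ^+ 2) * w i (face x d i b p).
  rewrite face_area// face_unit_normal// fw (bigD1 i)//= big1 => [|j ji].
    by rewrite !mxE !eqxx addr0 mulr1; ring.
  by rewrite !mxE eqxx/= (negbTE ji) mulr0 mul0r.
have patchT i : cube_patch x d (lshift 3 i) = face x d i true.
  by rewrite /cube_patch -[lshift 3 i]/(unsplit (inl i)) unsplitK.
have patchF i : cube_patch x d (rshift 3 i) = face x d i false.
  by rewrite /cube_patch -[rshift 3 i]/(unsplit (inr i)) unsplitK.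
have faceE i b : \int[area]_(p in square)
     (f (face x d i b p) (unit_normal (face x d i b) p) *
      euclid_norm (patch_normal (face x d i b) p)) =
   sgb b * (4 * d ^+ 2) * \int[area]_(p in square) w i (face x d i b p).
  have msq := measurable_square (R:=R).
  have Iw := face_integrable i b d0 oU (cw i) xU.
  have := RintegralZl (sgb b * (4 * d ^+ 2)) msq Iw.
  rewrite /= => <-.
  by apply: eq_Rintegral => p _; exact: fE.
pose I i b := \int[area]_(p in square) w i (face x d i b p).
have sE : surface_integral (cube_patch x d) f =
    \sum_i (sgb true * (4 * d ^+ 2) * I i true + sgb false * (4 * d ^+ 2) * I i false).
  rewrite /surface_integral big_split_ord big_split /=; congr (_ + _).
    by apply: eq_bigr => i _; rewrite patchT; exact: faceE.
  by apply: eq_bigr => i _; rewrite patchF; exact: faceE.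
rewrite sE mulr_sumr -sumrB.
apply: le_trans (ler_norm_sum _ _ _) _.
have -> : 24 * eps * d ^+ 3 = \sum_(i < 3) (4 * d ^+ 2) * (2 * eps * d).
  by rewrite sumr_const card_ord; ring.
apply: ler_sum => i _.
have d2 : 0 < 4 * d ^+ 2 by rewrite mulr_gt0// exprn_gt0.
have := face_pair_flux i d0 oU (cw i) xU (wL i).
rewrite -/(I i true) -/(I i false) => h.
apply: le_trans (ler_wpM2l (ltW d2) h).
rewrite -[X in X * `|_|](gtr0_norm d2) -normrM le_eqVlt; apply/orP; left.
by apply/eqP; congr (`|_|); rewrite /sgb; ring.
Qed.

End CubeFlux.

(** * Specific energy and its rate *)

Section SpecificEnergy.
Context {R : realType}.
Variables (T : set R) (Omega : set 'rV[R]_3) (u : R -> 'rV[R]_3 -> 'rV[R]_3)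
  (e : R -> 'rV[R]_3 -> R).

(** The fields below are in material description: X is a particle. *)
Definition material_velocity s X : 'rV[R]_3 := derive1 (u ^~ X) s.

Definition material_acceleration s X : 'rV[R]_3 :=
  derive1 (material_velocity ^~ X) s.

Definition material_energy s X : R := e s (motion u s X).

Definition specific_energy s X : R :=
  2^-1 * (\sum_i material_velocity s X 0 i * material_velocity s X 0 i) +
  material_energy s X.

Definition specific_power s X : R :=
  \sum_i material_velocity s X 0 i * material_acceleration s X 0 i +
  derive1 (material_energy ^~ X) s.

Hypotheses (hV : C1_in_time T Omega material_velocity)
  (hE : C1_in_time T Omega material_energy).

Lemma specific_energy_derive s X : T s -> Omega X ->
  is_derive s (1 : R) (specific_energy ^~ X) (specific_power s X).
Proof.
move=> Ts OX; have dV := hV.1 s X Ts OX; have dE := hE.1 s X Ts OX.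
have dVi i : is_derive s (1 : R) (fun s => material_velocity s X 0 i)
    (material_acceleration s X 0 i).
  apply: DeriveDef; first by move/derivable_mxP : dV; apply.
  by rewrite /material_acceleration derive1E derive_mx// mxE.
have dE' : is_derive s (1 : R) (material_energy ^~ X)
    (derive1 (material_energy ^~ X) s).
  by rewrite derive1E; exact: derivableP.
have -> : specific_energy ^~ X =
    2^-1 \*: (\sum_i (fun s => material_velocity s X 0 i) *
                      (fun s => material_velocity s X 0 i)) +
    material_energy ^~ X.
  by apply/funext => r; rewrite /specific_energy /= fctE /= fct_sumE.
apply: is_derive_eq; rewrite /specific_power; congr (_ + _).
rewrite scaler_sumr; apply: eq_bigr => i _.
by rewrite -![_ *: _]/(_ * _); field.
Qed.

Lemma specific_energy_continuous s : T s -> continuous_on Omega (specific_energy s).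
Proof.
move=> Ts X OX.
have cV := continuous_on_slice hV.2.1 Ts OX.
have cE := continuous_on_slice hE.2.1 Ts OX.
have cVi i : (fun X => material_velocity s X 0 i) @ X --> material_velocity s X 0 i.
  by apply: (@cvg_comp _ _ _ (material_velocity s) (fun A : 'rV[R]_3 => A 0 i) _
    (nbhs (material_velocity s X))) => //; exact: coord_continuous.
have cK : (fun X => \sum_i material_velocity s X 0 i * material_velocity s X 0 i) @ X
    --> \sum_i material_velocity s X 0 i * material_velocity s X 0 i.
  by apply: (@cvg_sumr _ _ (nbhs X)) => i; apply: cvgM; exact: cVi.
apply: (@continuousD _ _ _ (fun X => 2^-1 *
  (\sum_i material_velocity s X 0 i * material_velocity s X 0 i))
  (material_energy s)) cE.
by apply: continuousM cK; exact: cst_continuous.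
Qed.

Lemma specific_power_continuous :
  continuous_on (T `*` Omega) (fun p : R * 'rV[R]_3 => specific_power p.1 p.2).
Proof.
move=> [s X] [/= Ts OX].
have cV := hV.2.1 (s, X) (conj Ts OX).
have cA := hV.2.2 (s, X) (conj Ts OX).
have cE := hE.2.2 (s, X) (conj Ts OX).
have coord i (f : R * 'rV[R]_3 -> 'rV[R]_3) : {for (s, X), continuous f} ->
    (fun p => f p 0 i) @ (s, X) --> f (s, X) 0 i.
  move=> cf; apply: (@cvg_comp _ _ _ f (fun A : 'rV[R]_3 => A 0 i) _
    (nbhs (f (s, X)))) => //; exact: coord_continuous.
have cVi i := coord i (fun p => material_velocity p.1 p.2) cV.
have cAi i := coord i (fun p => material_acceleration p.1 p.2) cA.
apply: (@continuousD _ _ _ (fun p : R * 'rV[R]_3 => \sum_i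
  material_velocity p.1 p.2 0 i * material_acceleration p.1 p.2 0 i)
  (fun p => derive1 (material_energy ^~ p.2) p.1)) cE.
by apply: (@cvg_sumr _ _ (nbhs (s, X))) => i; apply: cvgM; [exact: cVi|exact: cAi].
Qed.

End SpecificEnergy.

(** * Localization of the energy balance *)

(** N is the volume of the cube, m its mass, and V1, S1, V2, S2 the powers of
    the body force and of the traction, the heat supply and the heat outflow.
    The factor of eps adds up the errors |c| on the mass, rho + 1 on the rate,
    1 on each body term and 3 on each boundary term. *)
Lemma balance_defect (R : realFieldType)
    (c rho fb fr Sw Sg N m V1 S1 V2 S2 eps : R) :
  0 < N -> 0 <= rho -> 0 < eps -> eps <= 1 ->
  `|m - rho * N| <= eps * N -> `|V1 - fb * N| <= eps * N ->
  `|S1 - N * Sw| <= 3 * (eps * N) -> `|V2 - fr * N| <= eps * N ->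
  `|S2 - N * Sg| <= 3 * (eps * N) ->
  `|V1 + S1 + V2 - S2 - c * m| <= eps * m ->
  `|c * rho - (fb + Sw + fr - Sg)| <= eps * (`|c| + rho + 9).
Proof.
move=> N0 rho0 e0 e1 hm hV1 hS1 hV2 hS2 rate.
have mN : m <= (rho + 1) * N.
  have : eps * N <= N by rewrite ger_pMl.
  move: hm; rewrite ler_norml => /andP[_]; rewrite mulrDl mul1r.
  by clear; move: (eps * N) (rho * N) => *; lra.
have -> : c * rho - (fb + Sw + fr - Sg) = N^-1 * (c * (rho * N - m) +
  (c * m - (V1 + S1 + V2 - S2)) + (V1 - fb * N) + (S1 - N * Sw) +
  (V2 - fr * N) - (S2 - N * Sg)).
  by field; rewrite gt_eqF.
rewrite normrM normfV (gtr0_norm N0) ler_pdivrMl//.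
have t1 : `|c * (rho * N - m)| <= `|c| * (eps * N).
  by rewrite normrM ler_wpM2l// distrC.
have t2 : `|c * m - (V1 + S1 + V2 - S2)| <= eps * ((rho + 1) * N).
  by rewrite distrC (le_trans rate)// ler_pM2l.
have -> : N * (eps * (`|c| + rho + 9)) = `|c| * (eps * N) +
  eps * ((rho + 1) * N) + eps * N + 3 * (eps * N) + eps * N + 3 * (eps * N).
  by ring.
apply: le_trans (ler_normB _ _) _; apply: lerD hS2.
do 3 (apply: le_trans (ler_normD _ _) _; apply: lerD => //).
by apply: le_trans (ler_normD _ _) _; apply: lerD.
Qed.

Theorem mainTheorem3 (R : realType) (alpha : R) (halpha : 0 < alpha < 1)
  (T : set R) (openT : open T) (intervalT : is_interval T)
  (Omega : set 'rV[R]_3) (openOmega : open Omega)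
  (u : R -> 'rV[R]_3 -> 'rV[R]_3) (rho e r : R -> 'rV[R]_3 -> R)
  (b q : R -> 'rV[R]_3 -> 'rV[R]_3) (sigma : R -> 'rV[R]_3 -> 'M[R]_3)
  (lA lB : 'I_3 -> R -> 'rV[R]_3 -> R)
  (hu : regular_motion Omega u T)
  (hl : forall i t x, T t -> body Omega u t x ->
    [/\ 0 < lA i t x, 0 < lB i t x
      & forall s, x 0 i - lB i t x <= s <= x 0 i + lA i t x ->
          body Omega u t (set_coord x i s)])
  (rho_ge0 : forall t x, T t -> body Omega u t x -> 0 <= rho t x)
  (hrho : forall t, T t -> continuous_on (body Omega u t) (rho t))
  (he : forall t, T t -> continuous_on (body Omega u t) (e t))
  (heD : C1_in_time T Omega (fun t X => e t (motion u t X)))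
  (hb : forall t, T t -> continuous_on (body Omega u t) (b t))
  (hr : forall t, T t -> continuous_on (body Omega u t) (r t))
  (hq : forall t, T t -> C1_on (body Omega u t) (q t))
  (hsigma : forall t, T t -> continuous_on (body Omega u t) (sigma t))
  (hIsigma : forall t, T t ->
    C1_on (body Omega u t) (fracint_stress alpha lA lB sigma t))
  (hmass : mass_conservation T Omega u rho)
  (henergy : energy_balance T Omega u rho e b r
    (nonlocal_traction alpha lA lB sigma) (heat_outflow q)) :
  forall t x, T t -> body Omega u t x ->
    rho t x * material_derive Omega u e t x
    + rho t x * (\sum_i (acceleration Omega u t x 0 i - b t x 0 i)
                        * velocity Omega u t x 0 i)
    - \sum_i 'D_('e_i)
        (fun y => \sum_j fracint_stress alpha lA lB sigma t y i j
                         * velocity Omega u t y 0 j) x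
    = rho t x * r t x - \sum_i 'D_('e_i) (fun y => q t y 0 i) x.
Proof.
move=> t x Tt Ux.
have [OX0 mX0] := bodyP Ux.
set X0 := particle Omega u t x in OX0 mX0.
have oU := body_open hu Tt.
have nU : nbhs x (body Omega u t) by exact: open_nbhs_nbhs.
pose v := velocity Omega u t.
have dv y : body Omega u t y -> differentiable v y.
  by move=> Uy; have [_ [_ /(_ t Tt)[_ _ _ /(_ y Uy)[]]]] := hu.
pose w i y := \sum_j fracint_stress alpha lA lB sigma t y i j * v y 0 j.
have dw i y : body Omega u t y -> differentiable (w i) y.
  move=> Uy; apply: differentiable_sumr => j; apply: differentiableM.
    by apply: differentiable_entry; have [] := hIsigma t Tt y Uy.
  by apply: differentiable_entry; exact: dv.
pose g i (y : 'rV[R]_3) : R := q t y 0 i.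
have dg i y : body Omega u t y -> differentiable (g i) y.
  by move=> Uy; apply: differentiable_entry; have [] := hq t Tt y Uy.
have cw i : continuous_on (body Omega u t) (w i).
  by move=> y Uy; apply: differentiable_continuous; exact: dw.
have cg i : continuous_on (body Omega u t) (g i).
  by move=> y Uy; apply: differentiable_continuous; exact: dg.
pose fb y := rho t y * \sum_i b t y 0 i * v y 0 i.
have cfb : continuous_on (body Omega u t) fb.
  move=> y Uy; apply: continuousM; first exact: (hrho t Tt).
  apply: (@cvg_sumr _ _ (nbhs y)) => i; apply: cvgM.
    exact: continuous_entry (hb t Tt y Uy).
  exact: continuous_entry (differentiable_continuous (dv y Uy)).
pose fr y := rho t y * r t y.
have cfr : continuous_on (body Omega u t) fr.
  by move=> y Uy; apply: continuousM; [exact: (hrho t Tt)|exact: (hr t Tt)].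
have hV : C1_in_time T Omega (material_velocity u) by have [_ []] := hu.
pose c := specific_power u e t X0.
pose Sw := \sum_i 'd (w i) x (delta_mx 0 i).
pose Sg := \sum_i 'd (g i) x (delta_mx 0 i).
pose W := fb x + Sw + fr x - Sg.
(* c is the rate of kinetic and internal energy per unit mass, W the power
   supplied per unit volume. *)
suff cW : c * rho t x - W = 0.
  have accE : acceleration Omega u t x = material_acceleration u t X0.
    rewrite /acceleration /material_derive /material_acceleration !derive1E.
    apply: near_eq_derive.
    have : nbhs t T by exact: open_nbhs_nbhs.
    apply: filterS => s Ts; rewrite /material_velocity -/X0.
    exact: (velocity_motion hu).
  have -> : \sum_i 'D_('e_i) (fun y => \sum_j fracint_stress alpha lA lB sigma t y i j *
      velocity Omega u t y 0 j) x = Sw.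
    by apply: eq_bigr => i _; exact: deriveE (dw i x Ux).
  have -> : \sum_i 'D_('e_i) (fun y => q t y 0 i) x = Sg.
    by apply: eq_bigr => i _; exact: deriveE (dg i x Ux).
  pose Sva := \sum_i material_velocity u t X0 0 i * material_acceleration u t X0 0 i.
  pose Sbv := \sum_i b t x 0 i * v x 0 i.
  have powerE : \sum_i (acceleration Omega u t x 0 i - b t x 0 i) *
      velocity Omega u t x 0 i = Sva - Sbv.
    by rewrite -sumrB; apply: eq_bigr => i _; rewrite accE mulrBl mulrC.
  have energyE : material_derive Omega u e t x = c - Sva.
    by rewrite /c /specific_power -/Sva [Sva + _]addrC addrK.
  rewrite powerE energyE.
  move/subr0_eq : cW; rewrite /W /fb -/Sbv /fr.
  by clear; move: Sw Sg c Sva Sbv (rho t x) (r t x) => *; lra.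
have rho0 := rho_ge0 t x Tt Ux.
apply: (@eq0_of_small _ _ (`|c| + rho t x + 9)) => [|eps /andP[e0 e1]].
  by rewrite ltr_wpDl// addr_ge0.
have near_value (f : 'rV[R]_3 -> R) : continuous_on (body Omega u t) f ->
    \forall d \near 0^'+, forall y, closed_ball x d y -> `|f y - f x| <= eps.
  move=> cf; apply: closed_ball_near.
  have := cf x Ux; move/cvgrPdist_le/(_ _ e0); apply: filterS => y.
  by rewrite distrC.
(* Joint continuity is needed here: the rate must stay near c for all times near
   t and all particles near X0 at once. *)
have [A [B [nA nB ABc]]] : exists A B, [/\ nbhs t A, nbhs X0 B &
    forall s X, A s -> B X -> `|specific_power u e s X - c| <= eps].
  have /cvgrPdist_le/(_ _ e0) := specific_power_continuous hV heD
    (conj Tt OX0 : (T `*` Omega) (t, X0)).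
  move=> [[A B] /= [nA nB] AB]; exists A, B; split=> // s X As BX.
  by rewrite distrC; exact: (AB (s, X)).
have nBx : nbhs x (particle Omega u t @^-1` B).
  exact: (particle_continuous hu Tt Ux).
pose expands (f : 'I_3 -> 'rV[R]_3 -> R) d := forall i y, `|y - x| <= d ->
  `|f i y - f i x - 'd (f i) x (y - x)| <= eps * d.
have near_expands f : (forall i, differentiable (f i) x) ->
    \forall d \near 0^'+, expands f d.
  move=> df.
  exact: filter_forall _ (fun i => differentiable_remainder (df i) e0).
have near_wg : \forall d \near 0^'+, expands w d /\ expands g d.
  by apply: filterI; apply: near_expands => i; [exact: dw|exact: dg].
near (0 : R)^'+ => d.
have d0 : 0 < d by near: d; exact: nbhs_right_gt.
have DU : closed_ball x d `<=` body Omega u t by near: d; apply: (closed_ball_near nU).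
have DB : closed_ball x d `<=` particle Omega u t @^-1` B.
  by near: d; exact: (closed_ball_near nBx).
have Dfb : forall y, closed_ball x d y -> `|fb y - fb x| <= eps.
  by near: d; exact: near_value.
have Dfr : forall y, closed_ball x d y -> `|fr y - fr x| <= eps.
  by near: d; exact: near_value.
have Drho : forall y, closed_ball x d y -> `|rho t y - rho t x| <= eps.
  by near: d; exact: near_value (hrho t Tt).
have [Dw Dg] : expands w d /\ expands g d by near: d.
pose D := closed_ball x d.
pose P := particle Omega u t @` D.
have cP : compact P.
  apply: continuous_compact (cube_compact d0).
  apply: continuous_in_subspaceT => y; rewrite inE => Dy.
  exact: (particle_continuous hu Tt (DU _ Dy)).
have PO : P `<=` Omega by move=> _ [y /DU/bodyP[OY _] <-].
have mP : motion u t @` P = D.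
  apply/seteqP; split=> [_ [_ [y Dy <-] <-]|y Dy].
    by have [_ ->] := bodyP (DU _ Dy).
  by exists (particle Omega u t y); [exists y|have [] := bodyP (DU _ Dy)].
pose N := 8 * d ^+ 3.
have N0 : 0 < N by rewrite mulr_gt0// exprn_gt0.
have := henergy P cP PO t Tt _ (cube_patch x d).
rewrite mP => /(_ (cube_boundary_patches x d0)).
set V1 := volume_integral D _; set S1 := surface_integral _ _.
set V2 := volume_integral D _; set S2 := surface_integral _ _.
move=> dG.
pose m := volume_integral D (rho t).
have hV1 : `|V1 - fb x * N| <= eps * N by exact: (cube_mean d0 oU cfb DU Dfb).
have hV2 : `|V2 - fr x * N| <= eps * N by exact: (cube_mean d0 oU cfr DU Dfr).
have hm : `|m - rho t x * N| <= eps * N by exact: (cube_mean d0 oU (hrho t Tt) DU Drho).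
have hS1 : `|S1 - N * Sw| <= 24 * eps * d ^+ 3.
  apply: (cube_flux d0 oU cw DU _ Dw) => y n.
  rewrite /nonlocal_traction /w.
  under eq_bigr do rewrite mxE mulr_suml.
  rewrite exchange_big; apply: eq_bigr => i _; rewrite mulr_sumr.
  by apply: eq_bigr => j _; rewrite mulrA.
have hS2 : `|S2 - N * Sg| <= 24 * eps * d ^+ 3.
  apply: (cube_flux d0 oU cg DU _ Dg) => y n.
  by rewrite /heat_outflow; apply: eq_bigr => i _; rewrite mulrC.
have rate : `|V1 + S1 + V2 - S2 - c * m| <= eps * m.
  rewrite /m -mP.
  apply: (@material_rate_bound _ T Omega u hu openT intervalT openOmega rho
    rho_ge0 hrho hmass (specific_energy u e)) => //.
  - by move=> s Ts; exact (specific_energy_continuous hV heD Ts).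
  - by move=> s X Ts OX; case: (specific_energy_derive hV heD Ts OX).
  - have nT : nbhs t T by exact: open_nbhs_nbhs.
    apply: filterS2 nA nT => s As Ts X [y Dy <-].
    have OY : Omega (particle Omega u t y) by have [] := bodyP (DU _ Dy).
    have dE := specific_energy_derive hV heD Ts OY.
    by rewrite derive1E derive_val; apply: ABc => //; exact: DB.
  - rewrite (_ : (fun s => _) = (fun s => volume_integral (motion u s @` P)
      (fun x => rho s x * (2^-1 * (\sum_i velocity Omega u s x 0 i *
         velocity Omega u s x 0 i) + e s x))))//.
    apply/funext => s; apply: eq_Rintegral => p; rewrite inE /= => Kp.
    have [_ mp] := bodyP (image_sub_body PO Kp).
    by rewrite /specific_energy /material_energy mp.
have flux : 24 * eps * d ^+ 3 = 3 * (eps * N) by rewrite /N; ring.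
rewrite flux in hS1 hS2.
exact: balance_defect N0 rho0 e0 e1 hm hV1 hS1 hV2 hS2 rate.
Unshelve. all: by end_near. Qed.
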